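(* Let $X$ and $Y$ be Banach spaces which are subspaces of WCG spaces. If $\mathcal{L}(X,Y^* )=\mathcal{K}(X,Y^* )$, then the projective tensor product $X\widehat{\otimes}_\pi Y$ is subspace of a WCG space.
   Context: All Banach spaces are real; an operator is a continuous linear map. $\mathcal{L}(X,Y^* )$ is the set of all operators from $X$ to $Y^*$ and $\mathcal{K}(X,Y^* )$ the set of all compact ones. A Banach space $X$ is weakly compactly generated (WCG) if there is a weakly compact set $G\subseteq X$ such that $X=\overline{\mathrm{span}}(G)$ (norm closed linear span). ''Subspace of a WCG space'' means isomorphic to a norm closed linear subspace of some WCG Banach space. *)

(* Defs.v *)
From HB Require Import structures.
From mathcomp Require Import all_boot all_order all_algebra.
From mathcomp Require Import all_classical all_reals.
From mathcomp Require Import interval_inference topology normedtype sequences.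
Set Implicit Arguments.
Unset Strict Implicit.
Unset Printing Implicit Defensive.
Import Order.TTheory GRing.Theory Num.Theory.
Import numFieldNormedType.Exports.
Local Open Scope classical_set_scope.
Local Open Scope quotient_scope.
Local Open Scope ring_scope.

Section Dual.
Variables (R : realType) (X : normedModType R).

Definition is_functional : {pred X -> R^o} :=
  fun f => `[< linear f /\ continuous f >].

Lemma is_functional_submod_closed : submod_closed is_functional.
Proof.
split.
  apply/asboolP; split; last by move=> x; exact: cvg_cst.
  by move=> a x y; rewrite scaler0 addr0.
move=> a f g /asboolP[lf cf] /asboolP[lg cg]; apply/asboolP; split.
  move=> b x y; rewrite /= !fctE lf lg !scalerDr !scalerA (mulrC a b).
  by rewrite addrACA.
move=> x; apply: cvgD; last exact: cg.
by apply: cvgZl_tmp; exact: cf.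
Qed.

HB.instance Definition _ :=
  GRing.isSubmodClosed.Build R (X -> R^o) is_functional
    is_functional_submod_closed.

Record dual := Dual {
  dual_fun :> X -> R^o;
  dual_prop : dual_fun \in is_functional }.

HB.instance Definition _ := [isSub for dual_fun].
HB.instance Definition _ := [Choice of dual by <:].
HB.instance Definition _ := [SubChoice_isSubLmodule of dual by <:].

Lemma dual_linear (f : dual) : linear f.
Proof. by have /asboolP[] := dual_prop f. Qed.

Lemma dual_continuous (f : dual) : continuous f.
Proof. by have /asboolP[] := dual_prop f. Qed.

HB.instance Definition _ (f : dual) :=
  GRing.isLinear.Build R X R^o _ f (dual_linear f).

Definition dual_norm (f : dual) : R := sup [set `|f x| | x in [set x | `|x| <= 1]].

Lemma dual_norm_has_sup (f : dual) :
  has_sup [set `|f x| | x in [set x : X | `|x| <= 1]].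
Proof.
split; first by exists `|f 0|; exists 0 => //=; rewrite normr0.
have /linear_bounded_continuous/linear_boundedP := @dual_continuous f.
case=> M [_ /(_ (M + 1))]; rewrite ltrDl => /(_ ltr01) fM.
exists `|M + 1| => _ [x /= x1 <-]; apply: (le_trans (fM x)).
apply: (le_trans (ler_norm _)); rewrite normrM normr_id.
by rewrite ler_piMr.
Qed.

Lemma dual_norm_ge0 (f : dual) : 0 <= dual_norm f.
Proof.
apply: le_trans (ub_le_sup (proj2 (dual_norm_has_sup f)) _); last first.
  by exists 0 => //=; rewrite normr0.
by rewrite normr_ge0.
Qed.

Lemma dual_normP (f : dual) x : `|f x| <= dual_norm f * `|x|.
Proof.
have [->|x0] := eqVneq x 0; first by rewrite linear0 !normr0 mulr0.
have nx : 0 < `|x| by rewrite normr_gt0.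
rewrite -ler_pdivrMr//; apply: ub_le_sup; first exact: (proj2 (dual_norm_has_sup f)).
exists (`|x|^-1 *: x) => /=.
  by rewrite normrZ normfV normr_id mulVf// gt_eqF.
by rewrite linearZ/= normrZ normfV normr_id mulrC.
Qed.

Lemma dual_norm_le (f : dual) M :
  (forall x, `|x| <= 1 -> `|f x| <= M) -> dual_norm f <= M.
Proof.
move=> fM; apply: ge_sup; first exact: (proj1 (dual_norm_has_sup f)).
by move=> _ [x /= x1 <-]; exact: fM.
Qed.

Lemma dual_normD (f g : dual) : dual_norm (f + g) <= dual_norm f + dual_norm g.
Proof.
apply: dual_norm_le => x x1.
rewrite [X in `|X|](_ : _ = f x + g x)//.
rewrite (le_trans (ler_normD _ _))// lerD//.
  by rewrite (le_trans (dual_normP _ _))// ler_piMr// dual_norm_ge0.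
by rewrite (le_trans (dual_normP _ _))// ler_piMr// dual_norm_ge0.
Qed.

Lemma dual_normZ_le (a : R) (f : dual) : dual_norm (a *: f) <= `|a| * dual_norm f.
Proof.
apply: dual_norm_le => x x1.
rewrite [X in `|X|](_ : _ = a *: f x)// normrZ ler_wpM2l//.
by rewrite (le_trans (dual_normP _ _))// ler_piMr// dual_norm_ge0.
Qed.

Lemma dual_normZ (a : R) (f : dual) : dual_norm (a *: f) = `|a| * dual_norm f.
Proof.
apply/eqP; rewrite eq_le dual_normZ_le/=.
have [->|a0] := eqVneq a 0; first by rewrite normr0 mul0r dual_norm_ge0.
have na : 0 < `|a| by rewrite normr_gt0.
rewrite -ler_pdivlMl// -normfV; apply: le_trans (dual_normZ_le _ _).
by rewrite scalerA mulVf// scale1r.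
Qed.

Lemma dual_norm0_eq0 (f : dual) : dual_norm f = 0 -> f = 0.
Proof.
move=> f0; apply/val_inj/funext => x /=.
by apply/eqP; rewrite -normr_le0 (le_trans (dual_normP _ _))// f0 mul0r.
Qed.

HB.instance Definition _ :=
  Lmodule_isNormed.Build R dual dual_normD dual_normZ dual_norm0_eq0.

End Dual.

(* sigma(X, X^* ): the initial topology for the canonical map of X into R^(X^* ) *)
Definition weak (R : realType) (X : normedModType R) : Type :=
  initial_topology (fun (x : X) => (fun f => f x) : {ptws dual X -> R^o}).

HB.instance Definition _ (R : realType) (X : normedModType R) :=
  Topological.on (weak X).

Definition weakly_compact (R : realType) (X : normedModType R) (G : set X) :=
  compact (G : set (weak X)).

Definition lspan (R : realType) (X : lmodType R) (G : set X) : set X :=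
  [set x | exists (n : nat) (a : 'I_n -> R) (g : 'I_n -> X),
     (forall i, G (g i)) /\ x = \sum_i a i *: g i].

Definition WCG (R : realType) (X : completeNormedModType R) : Prop :=
  exists G : set X, weakly_compact G /\ closure (lspan G) = setT.

(* The lower bound on j makes it injective, with a continuous inverse on its
   range. *)
Definition subspace_of_WCG (R : realType) (X : completeNormedModType R) : Prop :=
  exists W : completeNormedModType R, WCG W /\
  exists j : {linear X -> W},
    [/\ continuous j,
        exists2 c : R, 0 < c & forall x, c * `|x| <= `|j x|
      & closed (range j)].

Definition operators (R : realType) (X Z : normedModType R) :
    set {linear X -> Z} :=
  [set T : {linear X -> Z} | continuous T].

Definition compact_operators (R : realType) (X Z : normedModType R) :
    set {linear X -> Z} :=
  [set T : {linear X -> Z} |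
     continuous T /\ precompact (T @` [set x : X | `|x| <= 1])].

Arguments operators {R} X Z.
Arguments compact_operators {R} X Z.

Record seminorm (R : realType) (E : lmodType R) := Seminorm {
  snorm :> E -> R;
  snorm_ge0 : forall x, 0 <= snorm x;
  snormD : forall x y, snorm (x + y) <= snorm x + snorm y;
  snormZ : forall a x, snorm (a *: x) = `|a| * snorm x }.

Section SeminormTheory.
Variables (R : realType) (E : lmodType R) (p : seminorm E).

Lemma snorm0 : p 0 = 0.
Proof. by rewrite -(scale0r 0) snormZ normr0 mul0r. Qed.

Lemma snormN x : p (- x) = p x.
Proof. by rewrite -scaleN1r snormZ normrN normr1 mul1r. Qed.

Lemma snorm_distC x y : p (x - y) = p (y - x).
Proof. by rewrite -snormN opprB. Qed.

Lemma snorm_triangle y x z : p (x - z) <= p (x - y) + p (y - z).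
Proof. by rewrite -[x in p (x - z)](subrK y) -addrA snormD. Qed.

Lemma snorm_dist_le x y : `|p x - p y| <= p (x - y).
Proof.
rewrite ler_norml; apply/andP; split.
  by rewrite lerNl opprB lerBlDr snorm_distC -{1}(subrK x y) snormD.
by rewrite lerBlDr -{1}(subrK y x) snormD.
Qed.

End SeminormTheory.

(* The quotient of E by the kernel of p, normed by p *)
Section Separation.
Variables (R : realType) (E : lmodType R) (p : seminorm E).

Definition sep_rel : rel E := fun x y => p (x - y) == 0.

Lemma sep_rel_equiv : equiv_class_of sep_rel.
Proof.
split=> [x|x y|y x z]; rewrite /sep_rel.
- by rewrite subrr snorm0.
- by rewrite snorm_distC.
- move=> /eqP xy /eqP yz; apply/eqP/le_anti; rewrite snorm_ge0 andbT.
  by rewrite (le_trans (snorm_triangle p y x z))// xy yz addr0.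
Qed.

Canonical sep_equiv := EquivRelPack sep_rel_equiv.

Definition separated : Type := {eq_quot sep_equiv}.
HB.instance Definition _ := Choice.on separated.
HB.instance Definition _ := EqQuotient.on separated.

Definition sep_pi (x : E) : separated := \pi_separated x.

Lemma sep_piP x y : sep_pi x = sep_pi y <-> p (x - y) = 0.
Proof.
by rewrite /sep_pi; split=> [/eqP|/eqP xy]; [rewrite piE => /eqP|apply/eqP; rewrite piE].
Qed.

Lemma sep_pi_repr (a : separated) : sep_pi (repr a) = a.
Proof. exact: reprK. Qed.

Lemma sep_repr_pi x : p (repr (sep_pi x) - x) = 0.
Proof. by apply/sep_piP; rewrite sep_pi_repr. Qed.

Definition sep_zero : separated := sep_pi 0.
Definition sep_opp (a : separated) : separated := sep_pi (- repr a).
Definition sep_add (a b : separated) : separated := sep_pi (repr a + repr b).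
Definition sep_scale (k : R) (a : separated) : separated := sep_pi (k *: repr a).
Definition sep_norm (a : separated) : R := p (repr a).

Lemma sep_piN x : sep_opp (sep_pi x) = sep_pi (- x).
Proof. by apply/sep_piP; rewrite -opprB snormN opprK addrC sep_repr_pi. Qed.

Lemma sep_piD x y : sep_add (sep_pi x) (sep_pi y) = sep_pi (x + y).
Proof.
apply/sep_piP/le_anti; rewrite snorm_ge0 andbT opprD addrACA.
by rewrite (le_trans (snormD _ _ _))// !sep_repr_pi addr0.
Qed.

Lemma sep_piZ k x : sep_scale k (sep_pi x) = sep_pi (k *: x).
Proof. by apply/sep_piP; rewrite -scalerBr snormZ sep_repr_pi mulr0. Qed.

Lemma sep_norm_pi x : sep_norm (sep_pi x) = p x.
Proof.
apply/eqP; rewrite -subr_eq0 -normr_le0.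
by rewrite (le_trans (snorm_dist_le _ _ _))// sep_repr_pi.
Qed.

Lemma sep_ind (P : separated -> Prop) : (forall x, P (sep_pi x)) -> forall a, P a.
Proof. by move=> Ppi a; rewrite -(sep_pi_repr a). Qed.

Lemma sep_addA : associative sep_add.
Proof.
elim/sep_ind=> x; elim/sep_ind=> y; elim/sep_ind=> z.
by rewrite !sep_piD addrA.
Qed.

Lemma sep_addC : commutative sep_add.
Proof. by elim/sep_ind=> x; elim/sep_ind=> y; rewrite !sep_piD addrC. Qed.

Lemma sep_add0 : left_id sep_zero sep_add.
Proof. by elim/sep_ind=> x; rewrite sep_piD add0r. Qed.

Lemma sep_addN : left_inverse sep_zero sep_opp sep_add.
Proof. by elim/sep_ind=> x; rewrite sep_piN sep_piD addNr. Qed.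

HB.instance Definition _ :=
  GRing.isZmodule.Build separated sep_addA sep_addC sep_add0 sep_addN.

Lemma sep_scaleA a b v : sep_scale a (sep_scale b v) = sep_scale (a * b) v.
Proof. by elim/sep_ind: v => x; rewrite !sep_piZ scalerA. Qed.

Lemma sep_scale1 : left_id 1 sep_scale.
Proof. by elim/sep_ind=> x; rewrite sep_piZ scale1r. Qed.

Lemma sep_scaleDr : right_distributive sep_scale +%R.
Proof.
move=> a; elim/sep_ind=> x; elim/sep_ind=> y.
by rewrite /GRing.add/= !(sep_piD, sep_piZ) scalerDr.
Qed.

Lemma sep_scaleDl v : {morph sep_scale^~ v : a b / a + b}.
Proof.
elim/sep_ind: v => x a b.
by rewrite [RHS]/GRing.add/= !(sep_piD, sep_piZ) scalerDl.
Qed.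

HB.instance Definition _ := GRing.Zmodule_isLmodule.Build R separated
  sep_scaleA sep_scale1 sep_scaleDr sep_scaleDl.

Lemma sep_pi_linear : linear sep_pi.
Proof.
by move=> a x y; rewrite /GRing.add/= /GRing.scale/= sep_piZ sep_piD.
Qed.

HB.instance Definition _ :=
  GRing.isLinear.Build R E separated _ sep_pi sep_pi_linear.

Lemma sep_normD a b : sep_norm (a + b) <= sep_norm a + sep_norm b.
Proof.
elim/sep_ind: a => x; elim/sep_ind: b => y.
by rewrite -linearD !sep_norm_pi snormD.
Qed.

Lemma sep_normZ k a : sep_norm (k *: a) = `|k| * sep_norm a.
Proof. by elim/sep_ind: a => x; rewrite -linearZ !sep_norm_pi snormZ. Qed.

Lemma sep_norm0_eq0 a : sep_norm a = 0 -> a = 0.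
Proof.
elim/sep_ind: a => x; rewrite sep_norm_pi => x0.
by apply/sep_piP; rewrite subr0.
Qed.

HB.instance Definition _ := Lmodule_isNormed.Build R separated
  sep_normD sep_normZ sep_norm0_eq0.

Lemma norm_sep_pi x : `|sep_pi x| = p x.
Proof. exact: sep_norm_pi. Qed.

End Separation.

(* The p-Cauchy sequences, with the seminorm lim p (u n) *)
Section CauchySequences.
Variables (R : realType) (E : lmodType R) (p : seminorm E).

Definition is_cauchy_seq : {pred nat -> E} := fun u =>
  `[< forall e : R, 0 < e ->
        exists N, forall m n, (N <= m)%N -> (N <= n)%N -> p (u m - u n) < e >].

Lemma is_cauchy_seq_submod_closed : submod_closed is_cauchy_seq.
Proof.
split.
  by apply/asboolP => e e0; exists 0%N => m n _ _; rewrite subrr snorm0.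
move=> a u v /asboolP cu /asboolP cv; apply/asboolP => e e0.
have na : 0 < `|a| + 1 by rewrite ltr_wpDl.
have [N1 h1] := cu (e / 2 / (`|a| + 1)) ltac:(by rewrite !divr_gt0).
have [N2 h2] := cv (e / 2) ltac:(by rewrite divr_gt0).
exists (maxn N1 N2) => m n; rewrite !geq_max => /andP[m1 m2] /andP[n1 n2].
rewrite /= !fctE opprD addrACA -scalerBr (splitr e).
rewrite (le_lt_trans (snormD _ _ _))// ler_ltD ?h2// snormZ.
have := h1 _ _ m1 n1; rewrite ltr_pdivlMr// => /ltW; apply: le_trans.
by rewrite mulrC ler_wpM2l ?snorm_ge0// lerDl.
Qed.

HB.instance Definition _ :=
  GRing.isSubmodClosed.Build R (nat -> E) is_cauchy_seq
    is_cauchy_seq_submod_closed.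

Record cauchy_seq := CauchySeq {
  cseq_fun :> nat -> E;
  cseq_prop : cseq_fun \in is_cauchy_seq }.

HB.instance Definition _ := [isSub for cseq_fun].
HB.instance Definition _ := [Choice of cauchy_seq by <:].
HB.instance Definition _ := [SubChoice_isSubLmodule of cauchy_seq by <:].

Lemma cseqP (u : cauchy_seq) e : 0 < e ->
  exists N, forall m n, (N <= m)%N -> (N <= n)%N -> p (u m - u n) < e.
Proof. by have /asboolP := cseq_prop u; apply. Qed.

Lemma cseq_norm_cvg (u : cauchy_seq) : cvgn (fun n => p (u n)).
Proof.
apply/cauchy_cvgP/cauchy_exP => e e0.
have [N uN] := cseqP u e0.
exists (p (u N)), N => // n /= Nn.
rewrite -ball_normE /=.
by rewrite (le_lt_trans (snorm_dist_le _ _ _))// uN.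
Qed.

Definition cseq_norm (u : cauchy_seq) : R := limn (fun n => p (u n)).

Lemma cseq_norm_ge0 u : 0 <= cseq_norm u.
Proof.
apply: limr_ge; first exact: cseq_norm_cvg.
by apply: nearW => n; exact: snorm_ge0.
Qed.

Lemma cseq_normD u v : cseq_norm (u + v) <= cseq_norm u + cseq_norm v.
Proof.
rewrite /cseq_norm -limD; [|exact: cseq_norm_cvg..].
apply: ler_lim; first exact: cseq_norm_cvg.
  by apply: is_cvgD; exact: cseq_norm_cvg.
by apply: nearW => n; exact: snormD.
Qed.

Lemma cseq_normZ a u : cseq_norm (a *: u) = `|a| * cseq_norm u.
Proof.
apply/cvg_lim => //.
rewrite [X in X @ _](_ : _ = (fun n => `|a| * p (u n))).
  by apply: cvgMl_tmp; exact: cseq_norm_cvg.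
by apply/funext => n; exact: snormZ.
Qed.

Definition cseq_seminorm : seminorm cauchy_seq :=
  Seminorm cseq_norm_ge0 cseq_normD cseq_normZ.

Lemma cseq_cst_subproof (x : E) : (fun=> x) \in is_cauchy_seq.
Proof. by apply/asboolP => e e0; exists 0%N => m n _ _; rewrite subrr snorm0. Qed.

Definition cseq_cst (x : E) : cauchy_seq := CauchySeq (cseq_cst_subproof x).

End CauchySequences.

(* The Hausdorff completion of (E, p): Cauchy sequences modulo null sequences.
   It is the usual completion when p is a norm. *)
Section Completion.
Variables (R : realType) (E : lmodType R) (p : seminorm E).

Definition completion : Type := separated (cseq_seminorm p).

HB.instance Definition _ := NormedModule.on completion.

Definition embed (x : E) : completion := sep_pi (cseq_seminorm p) (cseq_cst p x).

Lemma embed_linear : linear embed.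
Proof.
by move=> a x y; rewrite /embed -linearP; congr (sep_pi _ _); exact: val_inj.
Qed.

HB.instance Definition _ :=
  GRing.isLinear.Build R E completion _ embed embed_linear.

Lemma norm_embed x : `|embed x| = p x.
Proof.
rewrite [LHS]norm_sep_pi /=; apply/cvg_lim => //.
exact: (@cvg_cst R (p x) nat \oo _).
Qed.

Lemma embed_cvg (u : cauchy_seq p) :
  embed (u n) @[n --> \oo] --> (sep_pi (cseq_seminorm p) u : completion).
Proof.
apply/cvgrPdist_le => e e0; have [N uN] := cseqP u e0.
exists N => // n /= Nn; rewrite /embed -linearB [leLHS]norm_sep_pi /=.
apply: limr_le; first exact: cseq_norm_cvg.
by exists N => // m /= Nm; exact/ltW/uN.
Qed.

Lemma embed_approx (a : completion) e : 0 < e -> exists x, `|a - embed x| < e.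
Proof.
move=> e0; elim/sep_ind: a => u.
have /cvgrPdist_lt/(_ _ e0)[N _ /(_ N (leqnn N)) uN] := @embed_cvg u.
by exists (u N).
Qed.

Lemma embed_dense : closure (range embed) = setT.
Proof.
apply/seteqP; split=> // a _ B /nbhs_ballP[e /= e0 aB].
have [x ax] := embed_approx a e0.
by exists (embed x); split; [exists x|apply: aB; rewrite -ball_normE].
Qed.

Lemma completion_complete (F : set_system completion) :
  ProperFilter F -> cauchy F -> cvg F.
Proof.
move=> FF /cauchyP cF.
pose e n : R := n.+1%:R^-1.
have e0 n : 0 < e n by rewrite invr_gt0.
have /choice[x Fx] n : exists x : E, F (ball (embed x) (e n)).
  have [a Fa] : exists a, F (ball a (e n / 2)) by apply: cF; rewrite divr_gt0.
  have [x ax] : exists x, `|a - embed x| < e n / 2.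
    by apply: embed_approx; rewrite divr_gt0.
  exists x; apply: filterS Fa => b; rewrite -!ball_normE /= => ab.
  rewrite -(subrKA a) (splitr (e n)) (le_lt_trans (ler_normD _ _))// ltrD//.
  by rewrite distrC.
have xmn m n : p (x m - x n) < e m + e n.
  have [b [/= bm bn]] := filter_ex (filterI (Fx m) (Fx n)).
  move: bm bn; rewrite -!ball_normE /= => bm bn.
  rewrite -norm_embed linearB /= -(subrKA b) (le_lt_trans (ler_normD _ _))//.
  by rewrite ltrD// distrC.
have esmall (d : R) : 0 < d -> exists N, forall n, (N <= n)%N -> e n < d.
  move=> /posnumP[{}d]; have [N _ h] := near_infty_natSinv_lt d.
  by exists N => n Nn; exact: h.
have xcauchy : x \in is_cauchy_seq p.
  apply/asboolP => d d0; have [N hN] := esmall _ (divr_gt0 d0 (ltr0Sn R 1)).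
  exists N => m n Nm Nn; rewrite (lt_trans (xmn _ _))// (splitr d).
  by rewrite ltrD ?hN.
pose a : completion := sep_pi (cseq_seminorm p) (CauchySeq xcauchy).
apply/cvg_ex; exists a; apply/cvgrPdist_lt => d d0.
have d2 : 0 < d / 2 by rewrite divr_gt0.
have /cvgrPdist_lt/(_ _ d2)[N1 _ h1] := @embed_cvg (CauchySeq xcauchy).
have [N2 h2] := esmall _ d2.
pose N := maxn N1 N2.
apply: filterS (Fx N) => b; rewrite -ball_normE /= => xb.
rewrite -(subrKA (embed (x N))) (splitr d) (le_lt_trans (ler_normD _ _))//.
rewrite ltrD//; first by apply: h1 => /=; exact: leq_maxl.
by rewrite (lt_trans xb)// h2// leq_maxr.
Qed.

HB.instance Definition _ :=
  Uniform_isComplete.Build completion completion_complete.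

End Completion.

Section ProjectiveTensorProduct.
Variables (R : realType) (X Y : normedModType R).

(* The sum of the x (x) y, (x, y) in s, as a linear form on the space of all
   bilinear forms on X * Y. Two such sums are equal if and only if they are
   equal in the algebraic tensor product. *)
Definition tsum (s : seq (X * Y)) : {bilinear X -> Y -> R^o} -> R^o :=
  fun A => \sum_(z <- s) A z.1 z.2.

Definition is_tensor : {pred {bilinear X -> Y -> R^o} -> R^o} :=
  fun u => `[< exists s, u = tsum s >].

Lemma tsum_cat s t : tsum (s ++ t) = tsum s + tsum t.
Proof. by apply/funext => A; rewrite /tsum big_cat. Qed.

Lemma tsum_scale a s : tsum [seq (a *: z.1, z.2) | z <- s] = a *: tsum s.
Proof.
apply/funext => A; rewrite /tsum big_map /= fctE /= scaler_sumr.
by apply: eq_bigr => z _; rewrite linearZl_LR.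
Qed.

Lemma is_tensor_submod_closed : submod_closed is_tensor.
Proof.
split; first by apply/asboolP; exists [::]; apply/funext => A; rewrite /tsum big_nil.
move=> a u v /asboolP[s ->] /asboolP[t ->]; apply/asboolP.
by exists ([seq (a *: z.1, z.2) | z <- s] ++ t); rewrite tsum_cat tsum_scale.
Qed.

HB.instance Definition _ :=
  GRing.isSubmodClosed.Build R ({bilinear X -> Y -> R^o} -> R^o) is_tensor
    is_tensor_submod_closed.

(* The algebraic tensor product of X and Y, as a space of such linear forms *)
Record tensor := Tensor {
  tensor_fun :> {bilinear X -> Y -> R^o} -> R^o;
  tensor_prop : tensor_fun \in is_tensor }.

HB.instance Definition _ := [isSub for tensor_fun].
HB.instance Definition _ := [Choice of tensor by <:].
HB.instance Definition _ := [SubChoice_isSubLmodule of tensor by <:].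

Definition tcost (s : seq (X * Y)) : R := \sum_(z <- s) `|z.1| * `|z.2|.

Definition proj_norm (u : tensor) : R :=
  inf [set tcost s | s in [set s | tensor_fun u = tsum s]].

Lemma tcost_ge0 s : 0 <= tcost s.
Proof. by apply: sumr_ge0 => z _; rewrite mulr_ge0. Qed.

Lemma proj_norm_has_inf u :
  has_inf [set tcost s | s in [set s | tensor_fun u = tsum s]].
Proof.
split; last by exists 0 => _ [s _ <-]; exact: tcost_ge0.
by have /asboolP[s us] := tensor_prop u; exists (tcost s), s.
Qed.

Lemma proj_norm_le u s : tensor_fun u = tsum s -> proj_norm u <= tcost s.
Proof. by move=> us; apply: ge_inf; [exact: (proj_norm_has_inf u).2|exists s]. Qed.

Lemma proj_norm_adherent u e : 0 < e ->
  exists2 s, tensor_fun u = tsum s & tcost s < proj_norm u + e.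
Proof. by move=> /inf_adherent/(_ (proj_norm_has_inf u))[_ [s us <-]]; exists s. Qed.

Lemma proj_norm_ge0 u : 0 <= proj_norm u.
Proof.
apply: lb_le_inf; first exact: (proj_norm_has_inf u).1.
by move=> _ [s _ <-]; exact: tcost_ge0.
Qed.

Lemma proj_normD u v : proj_norm (u + v) <= proj_norm u + proj_norm v.
Proof.
apply/ler_addgt0Pr => e e0.
have e2 : 0 < e / 2 by rewrite divr_gt0.
have [s us hs] := proj_norm_adherent u e2.
have [t vt ht] := proj_norm_adherent v e2.
have uv : tensor_fun (u + v) = tsum (s ++ t) by rewrite tsum_cat -us -vt.
rewrite (le_trans (proj_norm_le uv))// /tcost big_cat/=.
by rewrite (splitr e) addrACA lerD// ltW.
Qed.

Lemma proj_normZ_le a u : proj_norm (a *: u) <= `|a| * proj_norm u.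
Proof.
apply/ler_addgt0Pr => e e0.
have na : 0 < `|a| + 1 by rewrite ltr_wpDl.
have [s us hs] := proj_norm_adherent u (divr_gt0 e0 na).
have au : tensor_fun (a *: u) = tsum [seq (a *: z.1, z.2) | z <- s].
  by rewrite tsum_scale -us.
rewrite (le_trans (proj_norm_le au))// /tcost big_map /=.
under eq_bigr do rewrite normrZ -mulrA.
rewrite -mulr_sumr (le_trans (ler_wpM2l _ (ltW hs)))// mulrDr lerD2l.
by rewrite mulrCA ler_piMr ?(ltW e0)// ler_pdivrMr// mul1r lerDl.
Qed.

Lemma proj_normZ a u : proj_norm (a *: u) = `|a| * proj_norm u.
Proof.
apply/eqP; rewrite eq_le proj_normZ_le/=.
have [->|a0] := eqVneq a 0; first by rewrite normr0 mul0r proj_norm_ge0.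
have na : 0 < `|a| by rewrite normr_gt0.
rewrite -ler_pdivlMl// -normfV; apply: le_trans (proj_normZ_le _ _).
by rewrite scalerA mulVf// scale1r.
Qed.

Definition proj_seminorm : seminorm tensor :=
  Seminorm proj_norm_ge0 proj_normD proj_normZ.

(* proj_norm is a norm on tensor by the Hahn-Banach theorem, so the Hausdorff
   completion identifies no two distinct tensors. *)
Definition proj_tensor : completeNormedModType R := completion proj_seminorm.

End ProjectiveTensorProduct.

(* Main.v *)
(* Call a family (x_i) in X shrinking if for each e > 0 its index set is a
   countable union of sets on each of which every functional of norm at most 1
   has only finitely many values of modulus > e. A Banach space is a subspace of
   a WCG space if and only if it has a bounded total shrinking family.

   If (x_i) and (y_j) are such families in X and Y, then so is (x_i (x) y_j) in
   the projective tensor product: a functional is an operator T : X -> Y^*, which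
   is compact, so that T x_i is small in norm for all but finitely many i of each
   piece; for the other ones, T x_i is a single functional on Y.

   From a shrinking family to a WCG superspace: view E in the bounded functions on
   the unit ball of E^*, and replace f |-> f(x_i) by the function that vanishes
   where |f(x_i)| <= 1/p. For p fixed, these functions form countably many weakly
   null families and, for all i and p, they generate the values at the x_i.

   Conversely, let X be contained in a WCG space. Then, for each e > 0, X is a
   countable union of sets A whose weak* closures in X^** are within e of X.
   Hence the closure of each set under countably many well-chosen finitary
   operations spans a subspace which is the range of a norm one projection, and
   these projections are compatible. Along a well-ordering of X they give a long
   sequence of projections. By induction, the successive differences of these
   have ranges with total shrinking families, and the union of these families is
   shrinking: a cluster point of infinitely many x_t in A, with x_t in the range
   of the t-th difference, is of norm at most a multiple of e. *)

Require Import Defs.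
From HB Require Import structures.
From mathcomp Require Import all_boot all_order all_algebra.
From mathcomp Require Import all_classical all_reals.
From mathcomp Require Import interval_inference topology normedtype sequences.
From mathcomp Require wochoice.
From mathcomp Require Import ring lra.
Set Implicit Arguments.
Unset Strict Implicit.
Unset Printing Implicit Defensive.
Import Order.TTheory GRing.Theory Num.Theory.
Import numFieldNormedType.Exports.
Local Open Scope classical_set_scope.
Local Open Scope ring_scope.

(** * The Hahn-Banach theorem *)

Section HahnBanach.
Variable R : realType.

(** Homogeneity is only asked as an inequality: used for [a] and for [a^-1] it gives equality. *)
Definition sublinear (E : lmodType R) (q : E -> R) :=
  (forall x y, q (x + y) <= q x + q y) /\
  (forall a x, 0 <= a -> q (a *: x) <= a * q x).

Section Sublinear.
Variables (E : lmodType R) (q : E -> R).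
Hypothesis q_sub : sublinear q.

Lemma sublinearD x y : q (x + y) <= q x + q y.
Proof. exact: q_sub.1. Qed.

Lemma sublinear0 : q 0 = 0.
Proof.
apply/le_anti/andP; split.
  by have := q_sub.2 0 0 (lexx _); rewrite scale0r mul0r.
by have := sublinearD 0 0; rewrite addr0; lra.
Qed.

Lemma sublinearZ a x : 0 <= a -> q (a *: x) = a * q x.
Proof.
rewrite le_eqVlt => /predU1P[<-|a0]; first by rewrite scale0r sublinear0 mul0r.
apply/le_anti/andP; split; first exact: q_sub.2 (ltW a0).
have := q_sub.2 a^-1 (a *: x); rewrite scalerA mulVf ?gt_eqF// scale1r.
rewrite invr_ge0 => /(_ (ltW a0)); by rewrite ler_pdivlMl.
Qed.

Lemma sublinearN x : - q (- x) <= q x.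
Proof. by have := sublinearD x (- x); rewrite subrr sublinear0; lra. Qed.

End Sublinear.

Section InfConvolution.
Variables (V E : lmodType R) (q : E -> R) (D : set V).
Variables (j : {linear V -> E}) (f : {linear V -> R^o}).
Hypotheses (q_sub : sublinear q) (D0 : D 0).
Hypothesis DD : forall u v, D u -> D v -> D (u + v).
Hypothesis DZ : forall a v, 0 <= a -> D v -> D (a *: v).
Hypothesis fq : forall v, D v -> f v <= q (j v).

Let S z := [set q (z + j v) - f v | v in D].

(** The bounds [f v <= q (j v)] on the cone [D] keep the terms above [- q (- z)]. It serves with a
    ray for [D] to show that minimal sublinear functionals are linear, with a whole space to extend
    functionals, and with [f = 0] on a subspace as a quotient seminorm. *)
Definition inf_conv z := inf (S z).

Let S_has_inf z : has_inf (S z).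
Proof.
split; first by exists (q (z + j 0) - f 0), 0.
exists (- q (- z)) => _ [v Dv <-].
have := sublinearD q_sub (- z) (z + j v); rewrite addKr.
by have := fq Dv; lra.
Qed.

Lemma inf_conv_le z v : D v -> inf_conv z <= q (z + j v) - f v.
Proof. by move=> Dv; apply: ge_inf; [exact: (S_has_inf z).2|exists v]. Qed.

Lemma inf_conv_le0 z : inf_conv z <= q z.
Proof.
have := inf_conv_le z D0.
by rewrite (linear0 j) (linear0 f : _ = 0 :> R) addr0 subr0.
Qed.

Lemma inf_conv_sublinear : sublinear inf_conv.
Proof.
split=> [x y|a x].
  rewrite -lerBlDr; apply: lb_le_inf; first exact: (S_has_inf x).1.
  move=> _ [u Du <-]; rewrite lerBlDl -lerBlDr.
  apply: lb_le_inf; first exact: (S_has_inf y).1.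
  move=> _ [v Dv <-]; rewrite lerBlDl.
  apply: le_trans (inf_conv_le _ (DD Du Dv)) _.
  rewrite !linearD /= addrACA.
  by have := sublinearD q_sub (x + j u) (y + j v); lra.
rewrite le_eqVlt => /predU1P[<-|a0].
  by rewrite scale0r mul0r (le_trans (inf_conv_le0 _))// sublinear0.
rewrite -ler_pdivrMl//; apply: lb_le_inf; first exact: (S_has_inf x).1.
move=> _ [u Du <-]; rewrite ler_pdivrMl//.
apply: le_trans (inf_conv_le _ (DZ (ltW a0) Du)) _.
have -> : f (a *: u) = a * f u :> R by exact: linearZ.
by rewrite linearZ /= -scalerDr mulrBr (sublinearZ q_sub _ (ltW a0)).
Qed.

End InfConvolution.

Lemma minimal_sublinear (E : lmodType R) (q : E -> R) : sublinear q ->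
  exists p, [/\ sublinear p, forall x, p x <= q x &
    forall p', sublinear p' -> (forall x, p' x <= p x) -> p' = p].
Proof.
move=> q_sub.
pose T := {p : E -> R | sublinear p /\ forall x, p x <= q x}.
(* The order is reversed, so that the maximal elements of Zorn's lemma are minimal functionals. *)
pose le (s t : T) := `[< forall x, sval t x <= sval s x >].
have [|||A totA|[p [p_sub pq]] pmin] := @Zorn T le.
- by move=> t; apply/asboolP.
- move=> r s t /asboolP rs /asboolP st; apply/asboolP => x.
  exact: le_trans (st x) (rs x).
- move=> [s hs] [t ht] /asboolP /= st /asboolP /= ts; apply: eq_exist.
  by apply/funext => x; apply/le_anti; rewrite ts st.
- have [[t0 At0]|A0] := pselect (exists t, A t); last first.
    by exists (exist _ q (conj q_sub (fun x => lexx _))) => s As; case: A0; exists s.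
  pose B x := [set sval s x | s in A].
  (* Every member of the chain lies below [q], hence is at least [- q (- x)] at [x]. The pointwise
     infimum is subadditive because any two members are comparable. *)
  have Binf x : has_inf (B x).
    split; first by exists (sval t0 x), t0.
    exists (- q (- x)) => _ [[s [s_sub sq]] As <-] /=.
    by apply: le_trans (sublinearN s_sub x); rewrite lerN2.
  have Ble x s : A s -> inf (B x) <= sval s x.
    by move=> As; apply: ge_inf; [exact: (Binf x).2|exists s].
  have Bsub : sublinear (fun x => inf (B x)).
    split=> [x y|a x a0].
      rewrite -lerBlDr; apply: lb_le_inf; first exact: (Binf x).1.
      move=> _ [s As <-]; rewrite lerBlDl -lerBlDr.
      apply: lb_le_inf; first exact: (Binf y).1.
      move=> _ [t At <-]; rewrite lerBlDl.
      have [/asboolP st|/asboolP ts] := totA _ _ As At.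
        apply: le_trans (Ble _ _ At) _; have [t_sub _] := svalP t.
        by have := sublinearD t_sub x y; have := st x; lra.
      apply: le_trans (Ble _ _ As) _; have [s_sub _] := svalP s.
      by have := sublinearD s_sub x y; have := ts y; lra.
    move: a0; rewrite le_eqVlt => /predU1P[<-|a0].
      rewrite scale0r mul0r; apply: le_trans (Ble _ _ At0) _.
      by have [s_sub _] := svalP t0; rewrite (sublinear0 s_sub).
    rewrite -ler_pdivrMl//; apply: lb_le_inf; first exact: (Binf x).1.
    move=> _ [s As <-]; rewrite ler_pdivrMl//.
    apply: le_trans (Ble _ _ As) _; have [s_sub _] := svalP s.
    by rewrite (sublinearZ s_sub)// ltW.
  have Bq x : inf (B x) <= q x.
    by apply: le_trans (Ble _ _ At0) _; have [_] := svalP t0.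
  exists (exist _ (fun x => inf (B x)) (conj Bsub Bq) : T) => s As.
  by apply/asboolP => x; exact: Ble.
exists p; split=> // p' p'_sub p'p.
have p'q x : p' x <= q x by exact: le_trans (p'p x) (pq x).
have pp' : le (exist _ p (conj p_sub pq)) (exist _ p' (conj p'_sub p'q)).
  exact/asboolP.
exact: (congr1 sval (pmin _ pp')).
Qed.

(* A minimal sublinear functional p is linear: for each x, minimality forces
   p = inf_{t >= 0} (p(. + t x) - t p(x)), and thus p(-x) <= -p(x). *)
Lemma sublinear_dominates (E : lmodType R) (q : E -> R) : sublinear q ->
  exists g : {linear E -> R^o}, forall x, g x <= q x.
Proof.
move=> /minimal_sublinear[p [p_sub pq pmin]].
have pN x : p (- x) = - p x.
  apply/le_anti/andP; split; last by have := sublinearN p_sub x; lra.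
  pose D := [set t : R^o | 0 <= t].
  have lj : linear (fun t : R^o => t *: x).
    by move=> a s t; rewrite scalerDl scalerA.
  have lf : linear (fun t : R^o => t * p x : R^o).
    by move=> a s t; rewrite mulrDl scalerAl.
  pose j : {linear R^o -> E} := HB.pack (fun t : R^o => t *: x)
    (GRing.isLinear.Build _ _ _ _ _ lj).
  pose f : {linear R^o -> R^o} := HB.pack (fun t : R^o => t * p x : R^o)
    (GRing.isLinear.Build _ _ _ _ _ lf).
  have D0 : D 0 by exact: lexx.
  have DD u v : D u -> D v -> D (u + v) by exact: addr_ge0.
  have DZ a v : 0 <= a -> D v -> D (a *: v) by exact: mulr_ge0.
  have fq v : D v -> f v <= p (j v) by move=> Dv; rewrite /= (sublinearZ p_sub).
  have := pmin _ (inf_conv_sublinear p_sub D0 DD DZ fq)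
                 (inf_conv_le0 p_sub D0 fq).
  move=> pE; rewrite -[in leLHS]pE.
  have D1 : D 1 by exact: ler01.
  apply: le_trans (inf_conv_le p_sub D0 fq _ D1) _.
  by rewrite /= scale1r addNr (sublinear0 p_sub) mul1r sub0r.
have pD x y : p (x + y) = p x + p y.
  apply/le_anti; rewrite (sublinearD p_sub)/=.
  have := sublinearD p_sub (x + y) (- y).
  by rewrite addrK pN; lra.
have pl : linear (p : E -> R^o).
  move=> a x y; rewrite pD; congr (_ + _).
  have [a0|a0] := leP 0 a; first by rewrite (sublinearZ p_sub).
  rewrite -[a]opprK scaleNr pN (sublinearZ p_sub) ?oppr_ge0 ?ltW//.
  by rewrite scaleNr.
pose g : {linear E -> R^o} := HB.pack (p : E -> R^o)
    (GRing.isLinear.Build _ _ _ _ _ pl).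
by exists g.
Qed.

(** A linear functional [g] below the infimal convolution over all of [V] satisfies
    [g (j v) <= f v], by the term at [- v]; exchanging [v] and [- v] gives equality. *)
Lemma hahn_banach (V E : lmodType R) (q : E -> R) (j : {linear V -> E})
    (f : {linear V -> R^o}) :
  sublinear q -> (forall v, f v <= q (j v)) ->
  exists g : {linear E -> R^o},
    (forall x, g x <= q x) /\ (forall v, g (j v) = f v).
Proof.
move=> q_sub fq.
have DD (u v : V) : setT u -> setT v -> setT (u + v) by [].
have DZ (a : R) (v : V) : 0 <= a -> setT v -> setT (a *: v) by [].
have fqT v : setT v -> f v <= q (j v) by move=> _; exact: fq.
have [g gle] := sublinear_dominates (inf_conv_sublinear q_sub I DD DZ fqT).
have gj v : g (j v) <= f v.
  apply: le_trans (gle _) _.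
  apply: le_trans (inf_conv_le q_sub I fqT _ (I : setT (- v))) _.
  by rewrite !linearN /= subrr (sublinear0 q_sub) opprK add0r.
exists g; split=> [x|v].
  exact: le_trans (gle x) (inf_conv_le0 q_sub I fqT x).
apply/le_anti; rewrite gj /=.
by have := gj (- v); rewrite !linearN /=; lra.
Qed.

End HahnBanach.
(** * Ultrafilters, closed spans and functionals *)

Section Ultrafilters.

Lemma ultra_fmap (S T : Type) (U : set_system S) (f : S -> T) :
  UltraFilter U -> UltraFilter (f @ U).
Proof.
move=> UU; split=> [|G GF UG]; first exact: fmap_proper_filter.
apply/seteqP; split=> // A GA.
have [//|UnA] := in_ultra_setVsetC (f @^-1` A) UU.
by have [] := filter_ex (filterI GA (UG (~` A) UnA)) => x [].
Qed.

Lemma cofinite_ultra (T : Type) (J : set T) : infinite_set J ->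
  exists U : set_system T,
    [/\ UltraFilter U, U J & forall B, finite_set B -> U (~` B)].
Proof.
move=> Jinf; pose F := [set B : set T | finite_set (J `\` B)].
have FF : ProperFilter F.
  split; first by rewrite /F /= setD0.
  split.
  - by rewrite /F /= setDT; exact: finite_set0.
  - by move=> B B'; rewrite /F /= => fB fB'; rewrite setDIr finite_setU; split.
  - by move=> B B' BB'; apply: sub_finite_set; exact: setDS.
have [U [UU FU]] := ultraFilterLemma FF; exists U; split=> //.
  by apply: FU; rewrite /F /= setDv; exact: finite_set0.
move=> B fB; apply: FU; apply: sub_finite_set fB => x [_].
exact: contrapT.
Qed.

Lemma finite_ultra (T : Type) (U : set_system T) (A : set T) :
  UltraFilter U -> finite_set A -> U A -> exists2 a, A a & U [set a].
Proof.
(* Any type may be taken to be a [choiceType]; finite sets are then given by lists. *)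
elim/Pchoice: T => T in U A *.
move=> UU /finite_seqP[s ->]; elim: s => [|x s IHs] Us.
  by have [a] := filter_ex Us.
have [Ux|Ux] := in_ultra_setVsetC [set x] UU.
  by exists x => //=; exact: mem_head.
have [|a sa Ua] := IHs.
  apply: filterS (filterI Us Ux) => y [/=]; rewrite inE => /predU1P[->|//].
  by move=> /(_ erefl).
by exists a => //=; rewrite inE sa orbT.
Qed.

Lemma compact_ultra_cvg (S : Type) (T : topologicalType) (U : set_system S)
    (f : S -> T) (K : set T) :
  UltraFilter U -> compact K -> U (f @^-1` K) -> exists2 p, K p & f @ U --> p.
Proof.
move=> UU; rewrite compact_ultra => Kc UK.
by have [p [Kp fp]] := Kc _ (ultra_fmap f UU) UK; exists p.
Qed.

Lemma bounded_ultra_cvg (R : realType) (S : Type) (U : set_system S)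
    (u : S -> R) (M : R) :
  UltraFilter U -> U [set s | `|u s| <= M] -> exists l : R, u @ U --> l.
Proof.
move=> UU UM.
have [|l _ ul] := @compact_ultra_cvg S R U u _ UU (@segment_compact R (- M) M).
  by apply: filterS UM => s /=; rewrite in_itv /= -ler_norml.
by exists l.
Qed.

End Ultrafilters.

Section Subspaces.
Variable R : realType.

Lemma natSinv_small (d : R) :
  0 < d -> exists N, forall n, (N <= n)%N -> n.+1%:R^-1 < d.
Proof.
move=> /posnumP[{}d]; have [N _ hN] := near_infty_natSinv_lt d.
by exists N => n Nn; exact: hN.
Qed.

Definition subspace_set (X : lmodType R) (V : set X) :=
  V 0 /\ forall a u v, V u -> V v -> V (a *: u + v).

Lemma subspace_setD (X : lmodType R) (V : set X) u v :
  subspace_set V -> V u -> V v -> V (u + v).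
Proof. by move=> [_ Vl] Vu Vv; rewrite -[u]scale1r; exact: Vl. Qed.

Lemma subspace_setZ (X : lmodType R) (V : set X) a u :
  subspace_set V -> V u -> V (a *: u).
Proof. by move=> [V0 Vl] Vu; rewrite -[_ *: _]addr0; exact: Vl. Qed.

Lemma subspace_setB (X : lmodType R) (V : set X) u v :
  subspace_set V -> V u -> V v -> V (u - v).
Proof.
move=> Vs Vu Vv; apply: subspace_setD => //.
by rewrite -scaleN1r; exact: subspace_setZ.
Qed.

Lemma subspace_set_sum (X : lmodType R) (V : set X) (I : Type) (s : seq I)
    (u : I -> X) :
  subspace_set V -> (forall i, V (u i)) -> V (\sum_(i <- s) u i).
Proof.
move=> Vs Vu; elim/big_ind : _ => //; first exact: Vs.1.
by move=> x y Vx Vy; exact: subspace_setD.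
Qed.

Lemma lspan_min (X : lmodType R) (A V : set X) :
  subspace_set V -> A `<=` V -> lspan A `<=` V.
Proof.
move=> Vs AV _ [n [a [g [Ag ->]]]].
by apply: subspace_set_sum => // i; apply: subspace_setZ => //; exact: AV.
Qed.

Lemma sub_lspan (X : lmodType R) (A : set X) : A `<=` lspan A.
Proof.
move=> x Ax; exists 1%N, (fun=> 1), (fun=> x); split=> //.
by rewrite big_ord1 scale1r.
Qed.

Lemma lspan_subspace (X : lmodType R) (A : set X) : subspace_set (lspan A).
Proof.
split.
  by exists 0%N, (fun=> 0), (fun=> 0); split; [case|rewrite big_ord0].
move=> c _ _ [n [a [g [Ag ->]]]] [m [b [h [Ah ->]]]].
pose ab (i : 'I_(n + m)) :=
  match fintype.split i with inl i => c * a i | inr i => b i end.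
pose gh (i : 'I_(n + m)) := match fintype.split i with inl i => g i | inr i => h i end.
exists (n + m)%N, ab, gh; split; first by move=> i; rewrite /gh; case: fintype.split.
rewrite big_split_ord /= scaler_sumr; congr (_ + _); apply: eq_bigr => i _.
  rewrite /ab /gh scalerA.
  by have := unsplitK (inl i : 'I_n + 'I_m); rewrite /unsplit => ->.
rewrite /ab /gh.
by have := unsplitK (inr i : 'I_n + 'I_m); rewrite /unsplit => ->.
Qed.

Definition cspan (X : normedModType R) (A : set X) := closure (lspan A).

Lemma closure_normP (X : normedModType R) (A : set X) x :
  closure A x <-> forall e : R, 0 < e -> exists2 v, A v & `|x - v| < e.
Proof.
split=> [cx e e0|cx B /nbhs_ballP[e /= e0 xB]].
  have [v [Av]] := cx _ (nbhsx_ballx x e e0).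
  by rewrite -ball_normE /= => xv; exists v.
have [v Av xv] := cx e e0; exists v; split=> //.
by apply: xB; rewrite -ball_normE.
Qed.

Lemma closed_approx (X : normedModType R) (A : set X) x : closed A ->
  (forall e : R, 0 < e -> exists2 v, A v & `|x - v| < e) -> A x.
Proof. by move=> /closure_id{2}-> xA; apply/closure_normP. Qed.

Lemma closure_subspace (X : normedModType R) (A : set X) :
  subspace_set A -> subspace_set (closure A).
Proof.
move=> [A0 Al]; split; first exact: subset_closure.
move=> a u v /closure_normP cu /closure_normP cv; apply/closure_normP => e e0.
have na : 0 < `|a| + 1 by rewrite ltr_wpDl.
have [u' Au uu] := cu (e / 2 / (`|a| + 1)) ltac:(by rewrite !divr_gt0).
have [v' Av vv] := cv (e / 2) ltac:(by rewrite divr_gt0).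
exists (a *: u' + v'); first exact: Al.
rewrite opprD addrACA -scalerBr (splitr e).
apply: le_lt_trans (ler_normD _ _) _; apply: ler_ltD => //.
move: uu; rewrite ltr_pdivlMr// => /ltW; apply: le_trans.
by rewrite normrZ mulrC ler_wpM2l// lerDl.
Qed.

Lemma cspan_subspace (X : normedModType R) (A : set X) :
  subspace_set (cspan A).
Proof. exact/closure_subspace/lspan_subspace. Qed.

Lemma sub_cspan (X : normedModType R) (A : set X) : A `<=` cspan A.
Proof. by move=> x Ax; exact/subset_closure/sub_lspan. Qed.

Lemma closure_image_sub (X Y : normedModType R) (C : R) (T : {linear X -> Y})
    (A : set X) (B : set Y) :
  (forall x, `|T x| <= C * `|x|) -> (forall x, A x -> closure B (T x)) ->
  forall x, closure A x -> closure B (T x).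
Proof.
move=> TC AB x /closure_normP cx; apply: (closed_approx (@closed_closure _ B)) => e e0.
have C0 : 0 < `|C| + 1 by rewrite ltr_wpDl.
have [v Av xv] := cx (e / (`|C| + 1)) ltac:(by rewrite divr_gt0).
exists (T v); first exact: AB.
rewrite -linearB /=; apply: le_lt_trans (TC _) _.
apply: le_lt_trans (ler_wpM2r (normr_ge0 _) (ler_norm C)) _.
apply: (@le_lt_trans _ _ ((`|C| + 1) * `|x - v|)).
  by rewrite ler_wpM2r// lerDl.
by rewrite mulrC -ltr_pdivlMr.
Qed.

Lemma cspan_image_sub (X Y : normedModType R) (C : R) (T : {linear X -> Y})
    (A : set X) (B : set Y) :
  (forall x, `|T x| <= C * `|x|) -> (forall x, A x -> cspan B (T x)) ->
  forall x, cspan A x -> cspan B (T x).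
Proof.
move=> TC AB; apply: closure_image_sub TC _ => x.
apply: (@lspan_min _ _ [set x | cspan B (T x)]) => //.
have [B0 Bl] := cspan_subspace B.
split=> [|a u v Bu Bv]; first by rewrite /= linear0.
by rewrite /= linearP; exact: Bl.
Qed.

End Subspaces.

(** * Bounded functionals: extension, separation, norming *)

Section Functionals.
Variable R : realType.
Implicit Types X Y : normedModType R.

Lemma bounded_dual X (g : {linear X -> R^o}) (C : R) :
  0 <= C -> (forall x, `|g x : R| <= C * `|x|) ->
  exists f : dual X, `|f| <= C /\ forall x, f x = g x.
Proof.
move=> C0 gC.
have gf : (g : X -> R^o) \in @is_functional R X.
  apply/asboolP; split; first exact: linearP.
  apply: bounded_linear_continuous; apply/linear_boundedP.
  exists C; split=> [|M CM x]; first exact: ger0_real.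
  apply: le_trans (gC x) _.
  by rewrite ler_wpM2r// ltW.
exists (Dual gf); split=> //; apply: dual_norm_le => x x1 /=.
by apply: le_trans (gC x) _; rewrite ler_piMr.
Qed.

Lemma dual_le X (f : dual X) (x : X) (C : R) :
  `|f| <= C -> `|f x : R| <= C * `|x|.
Proof.
by move=> fC; apply: le_trans (dual_normP f x) _; rewrite ler_wpM2r.
Qed.

Lemma dual_le1 X (f : dual X) (x : X) : `|f| <= 1 -> `|f x : R| <= `|x|.
Proof. by move=> /(@dual_le _ _ x); rewrite mul1r. Qed.

Lemma dual_comp X Y (T : {linear X -> Y}) (C : R) (f : dual Y) :
  0 <= C -> (forall x, `|T x| <= C * `|x|) -> `|f| <= 1 ->
  exists g : dual X, `|g| <= C /\ forall x, g x = f (T x).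
Proof.
move=> C0 TC f1; apply: (@bounded_dual _ (f \o T : {linear X -> R^o}) C) => //.
by move=> x /=; apply: le_trans (dual_le1 _ f1) (TC x).
Qed.

Lemma norm_sublinear X (C : R) :
  0 <= C -> @sublinear R X (fun x => C * `|x|).
Proof.
move=> C0; split=> [x y|a x a0]; first by rewrite -mulrDr ler_wpM2l// ler_normD.
by rewrite normrZ ger0_norm// mulrCA.
Qed.

Lemma linear_norm_le (E : lmodType R) (q : E -> R) (g : {linear E -> R^o}) :
  (forall x, q (- x) = q x) -> (forall x, g x <= q x) ->
  forall x, `|g x : R| <= q x.
Proof.
move=> qN gq x; rewrite ler_norml gq andbT lerNl -qN.
by have := gq (- x); rewrite linearN.
Qed.

Lemma extend_functional X Y (j : {linear X -> Y}) (c : R) (f : dual X) :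
  0 < c -> (forall x, c * `|x| <= `|j x|) -> `|f| <= 1 ->
  exists g : dual Y, `|g| <= c^-1 /\ forall x, g (j x) = f x.
Proof.
move=> c0 jc f1.
have c'0 : 0 <= c^-1 by rewrite invr_ge0 ltW.
have fj x : (f : {linear X -> R^o}) x <= c^-1 * `|j x|.
  apply: le_trans (ler_norm _) _; apply: le_trans (dual_le1 _ f1) _.
  by rewrite ler_pdivlMl.
have [g [gle gj]] := hahn_banach (norm_sublinear Y c'0) fj.
have [|G [GC GE]] := @bounded_dual _ g c^-1 c'0.
  by apply: linear_norm_le => // x; rewrite normrN.
by exists G; split=> // x; rewrite GE.
Qed.

(** Apply the Hahn-Banach theorem to the quotient seminorm [q] modulo [V] and to
    [t *: z |-> t * q z] on the line through [z]. The extension vanishes on [V] because [q] does. *)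
Lemma distance_functional X (V : set X) (z : X) (r : R) :
  subspace_set V -> (forall v, V v -> r <= `|z - v|) ->
  exists f : dual X, [/\ `|f| <= 1, forall v, V v -> f v = 0 & r <= f z].
Proof.
move=> Vs rV.
have nsub := norm_sublinear X ler01.
pose idX : {linear X -> X} := idfun.
pose zr : {linear X -> R^o} := \0.
have VD u v : V u -> V v -> V (u + v) by exact: subspace_setD.
have VZ a v : 0 <= a -> V v -> V (a *: v) by move=> _; exact: subspace_setZ.
have zq v : V v -> zr v <= 1 * `|idX v| by move=> _; rewrite mul1r /=.
pose q := inf_conv (fun x : X => 1 * `|x|) V idX zr.
have qsub : sublinear q := inf_conv_sublinear nsub Vs.1 VD VZ zq.
have q_le u v : V v -> q u <= `|u + v|.
  move=> Vv; apply: le_trans (inf_conv_le nsub Vs.1 zq u Vv) _.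
  by rewrite mul1r subr0.
have q_ge0 u : 0 <= q u.
  apply: lb_le_inf; first by exists (1 * `|u + idX 0| - zr 0), 0 => //; exact: Vs.1.
  by move=> _ [v _ <-]; rewrite subr0 mul1r.
have qz : r <= q z.
  apply: lb_le_inf; first by exists (1 * `|z + idX 0| - zr 0), 0 => //; exact: Vs.1.
  move=> _ [v Vv <-]; rewrite subr0 mul1r.
  have := rV (- v); rewrite opprK; apply.
  by rewrite -scaleN1r; exact: subspace_setZ.
have lj : linear (fun t : R^o => t *: z).
  by move=> a s t; rewrite scalerDl scalerA.
have lf : linear (fun t : R^o => t * q z : R^o).
  by move=> a s t; rewrite mulrDl scalerAl.
pose j : {linear R^o -> X} := HB.pack (fun t : R^o => t *: z)
  (GRing.isLinear.Build _ _ _ _ _ lj).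
pose f : {linear R^o -> R^o} := HB.pack (fun t : R^o => t * q z : R^o)
  (GRing.isLinear.Build _ _ _ _ _ lf).
have fq t : f t <= q (j t).
  have [t0|t0] := leP 0 t; first by rewrite /= (sublinearZ qsub).
  apply: le_trans (q_ge0 _) => /=.
  by rewrite mulr_le0_ge0// ltW.
have [g [gle gj]] := hahn_banach qsub fq.
have gV v : V v -> g v <= 0.
  move=> Vv; apply: le_trans (gle _) _.
  have VNv : V (- v) by rewrite -scaleN1r; exact: subspace_setZ.
  by apply: le_trans (q_le _ _ VNv) _; rewrite subrr normr0.
have [|F [F1 FE]] := @bounded_dual _ g 1 ler01.
  apply: linear_norm_le => x; first by rewrite normrN.
  apply: le_trans (gle _) _.
  by apply: le_trans (q_le _ 0 Vs.1) _; rewrite addr0 mul1r.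
exists F; split=> //.
  move=> v Vv; rewrite FE; apply/le_anti; rewrite gV//=.
  have VNv : V (- v) by rewrite -scaleN1r; exact: subspace_setZ.
  by have := gV _ VNv; rewrite linearN /= oppr_le0.
by rewrite FE; have := gj 1; rewrite /= scale1r mul1r => ->.
Qed.

Lemma norming_functional X (x : X) :
  exists f : dual X, `|f| <= 1 /\ f x = `|x|.
Proof.
have s0 : subspace_set [set (0 : X)].
  by split=> // a u v -> ->; rewrite scaler0 addr0.
have [|f [f1 _ xf]] := @distance_functional _ _ x `|x| s0.
  by move=> v ->; rewrite subr0.
exists f; split=> //; apply/le_anti; rewrite xf andbT.
by apply: le_trans (ler_norm _) _; exact: dual_le1.
Qed.

End Functionals.
(** * Subspaces of WCG spaces are covered by almost weakly compact sets *)

Section EpsWeaklyCompact.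
Variable R : realType.

(* An e-weakly relatively compact set: its weak* cluster points in the bidual
   are within e of X. *)
Definition ewc (X : normedModType R) (e : R) (A : set X) :=
  forall U : set_system X, UltraFilter U -> U A ->
  exists y : X, forall g : dual X, `|g| <= 1 ->
    U [set z | `|g z - g y : R| <= e].

(** The countable cover is given as the partition into the fibres of a map to [nat]. This loses
    nothing, as [ewc] passes to subsets. *)
Definition ewc_covered (X : normedModType R) :=
  forall e : R, 0 < e ->
  exists k : X -> nat, forall n, ewc e [set x | k x = n].

Lemma weak_cvg (W : normedModType R) (S : Type) (U : set_system S)
    (k : S -> W) (p : W) (g : dual W) :
  Filter U -> k @ U --> (p : weak W) -> (fun s => g (k s) : R) @ U --> (g p : R).
Proof.
move=> UF kp.
pose phi := (fun (x : W) => (fun f => f x) : {ptws dual W -> R^o}).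
have h1 : (phi \o k) @ U --> phi p.
  apply: cvg_comp kp _.
  exact: (@initial_continuous W {ptws dual W -> R^o} phi p).
by have /pointwise_cvgP/(_ g) := h1.
Qed.

(** The countably many pairs [(n, N)] of a length and a bound on the coefficients will sort points
    into pieces. Coefficients and vectors are sequences, so that the length does not enter their
    types. *)
Lemma WCG_approx (W : completeNormedModType R) (G : set W) (z : W) (e : R) :
  closure (lspan G) = setT -> 0 < e ->
  exists (n N : nat) (a : nat -> R) (k : nat -> W),
    (forall i, (i < n)%N -> G (k i) /\ `|a i| <= N%:R) /\
    `|z - \sum_(i < n) a i *: k i| < e.
Proof.
move=> GT e0; have : closure (lspan G) z by rewrite GT.
move=> /closure_normP/(_ e e0)[_ [n [a [k [Gk ->]]]] zn].
pose a' (i : nat) := if insub i is Some j then a j else 0.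
pose k' (i : nat) := if insub i is Some j then k j else 0.
have a'E (i : 'I_n) : a' i = a i by rewrite /a' valK.
have k'E (i : 'I_n) : k' i = k i by rewrite /k' valK.
exists n, (Num.Def.truncn (\sum_i `|a i|)).+1, a', k'; split.
  move=> i ni; have := (a'E (Ordinal ni), k'E (Ordinal ni)) => /= -[-> ->].
  split=> //; apply: le_trans (ltW (Num.Theory.truncnS_gt _)).
  by rewrite (bigD1 (Ordinal ni))//= lerDl sumr_ge0.
by under eq_bigr do rewrite a'E k'E.
Qed.

(** For fixed [(n, N)] the approximating combinations have bounded coefficients and vectors in the
    weakly compact set [G], so they converge weakly along every ultrafilter on the piece. The limit
    is close to the range of [j] because the combinations are. *)
Lemma subspace_of_WCG_ewc (X : completeNormedModType R) :
  subspace_of_WCG X -> ewc_covered X.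
Proof.
move=> [W [[G [Gc GT]] [j [jcont [c c0 jc] _]]]] e e0.
(* The final estimate is [d + d + 2 * d] times [c^-1], the norm bound for functionals extended from
   [X] to [W]. *)
pose d := c * e / 4.
have d0 : 0 < d by rewrite divr_gt0// mulr_gt0.
have /choice[n /choice[N /choice[a /choice[k nNak]]]] (x : X) :=
  WCG_approx (j x) GT d0.
pose s x := \sum_(i < n x) a x i *: k x i.
have sd x : `|j x - s x| < d by have [] := nNak x.
exists (fun x => pickle (n x, N x)) => m U UU UA.
have [x0 x0m] := filter_ex UA.
pose n0 := n x0; pose N0 := N x0.
have UnN : U [set x | n x = n0 /\ N x = N0].
  apply: filterS UA => x /= xm; have : pickle (n x, N x) = pickle (n0, N0).
    by rewrite xm -x0m.
  by move=> /(pcan_inj pickleK)[-> ->].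
have /choice[abar abarE] (i : 'I_n0) : exists b : R, (fun x => a x i) @ U --> b.
  apply: (bounded_ultra_cvg (M := N0%:R)).
  apply: filterS UnN => x /= [xn xN]; have [+ _] := nNak x.
  by rewrite xn xN => /(_ i (ltn_ord i))[].
have /choice[kbar kbarE] (i : 'I_n0) : exists b : W,
    forall g : dual W, (fun x => g (k x i) : R) @ U --> (g b : R).
  have [|p Gp kp] := @compact_ultra_cvg X (weak W) U (fun x => k x i) G UU Gc.
    apply: filterS UnN => x /= [xn xN]; have [+ _] := nNak x.
    by rewrite xn => /(_ i (ltn_ord i))[].
  by exists p => g; exact: weak_cvg.
pose z := \sum_(i < n0) abar i *: kbar i.
have sz (g : dual W) : (fun x => g (s x) : R) @ U --> (g z : R).
  have -> : g z = \sum_(i < n0) abar i * g (kbar i) :> R.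
    by rewrite /z linear_sum; apply: eq_bigr => i _; rewrite linearZ.
  have : (fun x => \sum_(i < n0) a x i * g (k x i) : R) @ U -->
      \sum_(i < n0) abar i * g (kbar i).
    apply: cvg_big => [u|i _]; first exact: add_continuous.
    by apply: cvgM; [exact: abarE|exact: kbarE].
  apply: cvg_trans; apply: near_eq_cvg.
  apply: filterS UnN => x /= [xn _]; rewrite /s xn linear_sum.
  by apply: eq_bigr => i _; rewrite linearZ.
(* A functional of norm at most 1 vanishing on [range j] is at most [d] at the [s x], hence at the
   limit [z]; it cannot be [2 * d] there. *)
have [y zy] : exists y, `|z - j y| <= 2 * d.
  apply: contrapT => noy.
  have rs : subspace_set (range j).
    split; first by exists 0 => //; rewrite linear0.
    by move=> b _ _ [u _ <-] [v _ <-]; exists (b *: u + v) => //; rewrite linearP.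
  have [|g [g1 gj gz]] := @distance_functional _ _ (range j) z (2 * d) rs.
    move=> _ [y _ <-]; apply: ltW; rewrite ltNge; apply/negP => zy.
    by apply: noy; exists y.
  have : g z <= d :> R.
    apply: (@cvgr_to_le _ U _ _ (fun x => g (s x) : R) _ d) => //.
    near=> x.
    have -> : g (s x) = - g (j x - s x) :> R.
      have -> : g (j x - s x) = g (j x) - g (s x) :> R by exact: linearB.
      by rewrite (gj (j x)) ?sub0r ?opprK//; exists x.
    apply: le_trans (ler_norm _) _; rewrite normrN.
    exact: le_trans (dual_le1 _ g1) (ltW (sd x)).
  by move=> gzd; have := le_trans gz gzd; rewrite ger_pMl// lern1.
exists y => g g1.
have [h [hc hj]] := extend_functional c0 jc g1.
have dc0 : 0 < d / c by rewrite divr_gt0.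
have hU : U [set x | `|(h z : R) - h (s x)| <= d / c].
  by have /cvgrPdist_le/(_ _ dc0) := sz h.
apply: filterS hU => x /= xz.
rewrite -hj -hj -linearB /=.
have -> : j x - j y = (j x - s x) + (s x - z) + (z - j y) by rewrite !subrKA.
rewrite 2!(linearD h) /=.
have h1 : `|h (j x - s x) : R| <= d / c.
  by apply: le_trans (dual_le _ hc) _; rewrite mulrC ler_wpM2r ?invr_ge0 ?ltW.
have h2 : `|h (s x - z) : R| <= d / c by rewrite linearB /= distrC.
have h3 : `|h (z - j y) : R| <= 2 * (d / c).
  apply: le_trans (dual_le _ hc) _.
  by rewrite mulrA [leRHS]mulrC ler_wpM2l// invr_ge0 ltW.
have -> : e = d / c + d / c + 2 * (d / c) by rewrite /d; field; rewrite gt_eqF.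
apply: le_trans (ler_normD _ _) _; rewrite lerD//.
by apply: le_trans (ler_normD _ _) _; exact: lerD.
Unshelve. all: by end_near.
Qed.

End EpsWeaklyCompact.
(** * Compatible projections *)

Section FinitaryClosure.
Variables (T : choiceType) (I : countType) (F : I -> seq T -> T).

Inductive gen (S : set T) : T -> Prop :=
| gen_in x : S x -> gen S x
| gen_op i l : (forall x, x \in l -> gen S x) -> gen S (F i l).

Lemma gen_mono (S S' : set T) : S `<=` S' -> gen S `<=` gen S'.
Proof.
move=> SS' x; elim=> {x} [x /SS' S'x|i l _ IH]; first exact: gen_in.
exact: gen_op.
Qed.

(** Only finitely many elements of [D] enter the construction of [x], and the largest of them serves
    as [u]. This gives the continuity of hulls at limit stages. *)
Lemma gen_finitary (le : rel T) (D A : set T) x :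
  total le -> transitive le -> gen (D `|` A) x ->
  gen A x \/ exists2 u, D u & gen ([set v | le v u] `|` A) x.
Proof.
move=> le_tot le_tr; have le_refl u : le u u by have := le_tot u u; rewrite orbb.
elim=> {x} [x [Dx|Ax]|i l _ IH].
- by right; exists x => //; apply: gen_in; left; exact: le_refl.
- by left; exact: gen_in.
have : (forall y, y \in l -> gen A y) \/ exists2 u, D u &
    forall y, y \in l -> gen ([set v | le v u] `|` A) y.
  elim: l IH => [|y l IHl] IH; first by left.
  have IHl' := IHl (fun z zl => IH z (mem_behead (s := y :: l) zl)).
  have IHy := IH y (mem_head y l).
  have up (u w : T) : le u w ->
      gen ([set v | le v u] `|` A) `<=` gen ([set v | le v w] `|` A).
    move=> uw; apply: gen_mono => z [zu|Az]; last by right.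
    by left; exact: le_tr zu uw.
  have up0 (u : T) : gen A `<=` gen ([set v | le v u] `|` A).
    by apply: gen_mono => z Az; right.
  case: IHy IHl' => [Ay|[u Du uy]] [Al|[w Dw wl]].
  - by left=> z; rewrite inE => /predU1P[->//|]; exact: Al.
  - right; exists w => // z; rewrite inE => /predU1P[->|]; last exact: wl.
    exact: up0.
  - right; exists u => // z; rewrite inE => /predU1P[->//|zl].
    exact/up0/Al.
  - have [uw|wu] := orP (le_tot u w).
      right; exists w => // z; rewrite inE => /predU1P[->|]; last exact: wl.
      exact: up uw _ _.
    right; exists u => // z; rewrite inE => /predU1P[->//|zl].
    exact/(up _ _ wu)/wl.
by case=> [Al|[u Du ul]]; [left|right; exists u => //]; exact: gen_op.
Qed.

(** The generated elements are values of finite terms, coded by trees: a leaf holds a position in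
    [s], a node the code of an operation. Meaningless codes get the value [x0]. *)
Lemma gen_countable (x0 : T) (s : seq T) :
  exists e : nat -> T, gen [set x | x \in s] `<=` range e.
Proof.
pose fix eval (t : GenTree.tree nat) : T := match t with
  | GenTree.Leaf n => nth x0 s n
  | GenTree.Node n ts => if unpickle n is Some i then F i (map eval ts) else x0
  end.
exists (fun n => if unpickle n is Some t then eval t else x0) => x gx.
suff [t <-] : exists t, eval t = x.
  by exists (pickle t) => //; rewrite pickleK.
elim: gx => {x} [x xs|i l _ IH].
  by exists (GenTree.Leaf (index x s)); rewrite /= nth_index.
have [ts tsl] : exists ts, map eval ts = l.
  elim: l IH => [|y l IHl] IH; first by exists [::].
  have [ts tsl] := IHl (fun z zl => IH z (mem_behead (s := y :: l) zl)).
  have [t ty] := IH y (mem_head y l).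
  by exists (t :: ts); rewrite /= ty tsl.
by exists (GenTree.Node (pickle i) ts); rewrite /= pickleK tsl.
Qed.

End FinitaryClosure.

(** * Norm one projections onto hulls *)

Section Projections.
Variables (R : realType) (X : completeNormedModType R).
Variables (k : nat -> X -> nat) (h : X -> dual X).
Hypothesis k_ewc : forall p n, ewc p.+1%:R^-1 [set x | k p x = n].
Hypothesis h_norming : forall x, `|h x| <= 1 /\ h x x = `|x|.

(* Closing a set under these operations is a substitute for the passage to an
   elementary submodel. *)
Definition skolem_cond (p n m : nat) (q : seq rat) (l : seq X) (a : X) :=
  k p a = n /\ forall i, (i < size l)%N ->
    `|h (nth 0 l i) a - ratr (nth 0 q i) : R| < m.+1%:R^-1.

Definition skolem (i : rat + nat * nat * nat * seq rat) (l : seq X) : X :=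
  match i with
  | inl q => ratr q *: nth 0 l 0 + nth 0 l 1
  | inr (p, n, m, q) => xget 0 [set a | skolem_cond p n m q l a]
  end.

Let C := gen skolem.
Definition hull (S : set X) := closure (C S).

Lemma hull_gen S x : C S x -> hull S x. Proof. exact: subset_closure. Qed.

Lemma gen_rat_linear S (q : rat) x y : C S x -> C S y -> C S (ratr q *: x + y).
Proof.
move=> Cx Cy; apply: (@gen_op _ _ skolem S (inl q) [:: x; y]) => z.
by rewrite !inE => /orP[/eqP->|/eqP->].
Qed.

Lemma gen0 S : C S 0.
Proof.
have -> : 0 = skolem (inl 0) [::] by rewrite /= scaler0 addr0.
exact: gen_op.
Qed.

Lemma rat_approx (a e : R) : 0 < e -> exists q : rat, `|a - ratr q| < e.
Proof.
move=> e0; have [|q] := @rat_in_itvoo R (a - e) (a + e); first by lra.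
by rewrite in_itv /= => aq; exists q; rewrite ltr_norml; move: aq; lra.
Qed.

Lemma hull_subspace S : subspace_set (hull S).
Proof.
split; first exact/hull_gen/gen0.
move=> a x y hx hy.
have rl (q : rat) : hull S (ratr q *: x + y).
  apply/closure_normP => e e0.
  have nq : 0 < `|ratr q : R| + 1 by rewrite ltr_wpDl.
  have /closure_normP/(_ (e / 2 / (`|ratr q| + 1)))[|x' Cx xx] := hx.
    by rewrite !divr_gt0.
  have /closure_normP/(_ (e / 2))[|y' Cy yy] := hy.
    by rewrite divr_gt0.
  exists (ratr q *: x' + y'); first exact: gen_rat_linear.
  rewrite opprD addrACA -scalerBr (splitr e).
  apply: le_lt_trans (ler_normD _ _) _; apply: ler_ltD => //.
  move: xx; rewrite ltr_pdivlMr// => /ltW; apply: le_trans.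
  by rewrite normrZ mulrC ler_wpM2l// lerDl.
apply: (closed_approx (@closed_closure _ _)) => e e0.
have nx : 0 < `|x| + 1 by rewrite ltr_wpDl.
have [q aq] := rat_approx a (divr_gt0 e0 nx).
exists (ratr q *: x + y); first exact: rl.
rewrite opprD addrACA subrr addr0 -scalerBl normrZ.
apply: le_lt_trans (_ : _ <= `|a - ratr q| * (`|x| + 1)) _.
  by rewrite ler_wpM2l// lerDl.
by rewrite -ltr_pdivlMr.
Qed.

Lemma h_le1 x y : `|h x y : R| <= `|y|.
Proof. by apply: dual_le1; have [] := h_norming x. Qed.

(** For [c] in [C S] close to [x], the value [h c x] is close to [h c c], which is the norm of [c].
    Thus the functionals [h c] norm the hull. *)
Lemma hull_norm_le S x (b : R) :
  hull S x -> (forall c, C S c -> `|h c x : R| <= b) -> `|x| <= b.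
Proof.
move=> /closure_normP Sx xb; apply/ler_addgt0Pr => e e0.
have [c Cc xc] := Sx (e / 2) ltac:(by rewrite divr_gt0).
have [_ hcc] := h_norming c.
have hxc : `|h c (x - c) : R| <= e / 2.
  exact: le_trans (h_le1 _ _) (ltW xc).
have xcE : h c (x - c) = h c x - h c c :> R by exact: linearB.
have := xb _ Cc; have := ler_norm (h c x : R).
move: hxc; rewrite xcE hcc ler_norml => /andP[h1 h2] h3 h4.
have := ler_normD (x - c) c; rewrite subrK => h5.
by rewrite (splitr e); move: xc; lra.
Qed.

(** Elements of [C S] in the piece of [x] imitate [x] on any finitely many [h c]. An ultrafilter of
    ever better imitations is weakly within [e] of some [y0], which in turn is near the hull. The
    bound [4 * e] is [e] for the imitation, [e] for the piece and [2 * e] for the passage from [y0]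
    to [y]. *)
Lemma hull_approx S x p :
  exists2 y, hull S y & forall c, C S c -> `|h c (x - y) : R| <= 4 * p.+1%:R^-1.
Proof.
set e : R := p.+1%:R^-1; have e0 : 0 < e by rewrite invr_gt0.
pose A := [set a | k p a = k p x /\ C S a].
pose B (ld : seq X * R) := A `&` [set a | forall c, c \in ld.1 ->
  `|h c a - h c x : R| < ld.2].
pose Dom := [set ld : seq X * R | (forall c, c \in ld.1 -> C S c) /\ 0 < ld.2].
have Bn0 ld : Dom ld -> B ld !=set0.
  case: ld => l d [/= Sl d0].
  have d2 : 0 < d / 2 by rewrite divr_gt0.
  have [m md] : exists m : nat, m.+1%:R^-1 < d / 2 :> R.
    by have [m md] := natSinv_small d2; exists m; exact: md.
  have /choice[q qP] (c : X) : exists q : rat, `|(h c x : R) - ratr q| < m.+1%:R^-1.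
    by apply: rat_approx; rewrite invr_gt0.
  (* The condition on [a], with rational approximations to the values [h c x], is met by [x] itself,
     so [xget] does not fall back on its default. *)
  pose a := skolem (inr (p, k p x, m, map q l)) l.
  have [ka ca] : skolem_cond p (k p x) m (map q l) l a.
    apply: (@xgetPex _ 0 [set a | skolem_cond p (k p x) m (map q l) l a]).
    by exists x; split=> // i il; rewrite (nth_map 0).
  exists a; split; first by split=> //; exact: gen_op.
  move=> c /= cl.
  have := ca (index c l); rewrite index_mem (nth_map 0) ?index_mem// nth_index//.
  move=> /(_ cl) caq; have := qP c; rewrite distrC => cxq.
  have -> : (h c a : R) - h c x = (h c a - ratr (q c)) + (ratr (q c) - h c x).
    by rewrite addrA subrK.
  apply: le_lt_trans (ler_normD _ _) _.
  by rewrite (splitr d) ltrD// (lt_trans _ md).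
have Ffil : ProperFilter (filter_from Dom B).
  apply: filter_from_proper => //; apply: filter_from_filter.
    by exists ([::], 1); split=> //=; exact: ltr01.
  move=> [l d] [l' d'] [/= Sl d0] [/= Sl' d0'].
  exists (l ++ l', Num.min d d').
    split=> [c|]; last by rewrite lt_min d0.
    by rewrite mem_cat => /orP[/Sl|/Sl'].
  move=> a [Aa al]; split; split=> // c cl /=.
    by have := al c; rewrite /= mem_cat cl => /(_ isT); rewrite lt_min => /andP[].
  by have := al c; rewrite /= mem_cat cl orbT => /(_ isT); rewrite lt_min => /andP[].
have [U [UU FU]] := ultraFilterLemma Ffil.
have UB ld : Dom ld -> U (B ld) by move=> Dld; apply: FU; exists ld.
have UA : U A.
  by apply: filterS (UB ([::], 1) _) => [a []//|]; split=> //=; exact: ltr01.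
have [|y0 y0P] := @k_ewc p (k p x) U UU; first by apply: filterS UA => a [].
(* Otherwise a functional of norm at most 1 vanishes on the hull and is at least [2 * e] at [y0],
   although it differs by at most [e] between [y0] and some element of [C S]. *)
have [y Sy y0y] : exists2 y, hull S y & `|y0 - y| < 2 * e.
  apply: contrapT => noy.
  have [|g [g1 gS gy0]] := @distance_functional _ _ (hull S) y0 (2 * e)
      (hull_subspace S).
    move=> y Sy; rewrite leNgt; apply/negP => y0y.
    by apply: noy; exists y.
  have [a [[_ Ca]]] := filter_ex (filterI UA (y0P g g1)).
  rewrite /= (gS a); last exact: hull_gen.
  rewrite sub0r normrN => /(le_trans (ler_norm _)) /(le_trans gy0).
  by rewrite ger_pMl// lern1.
exists y => // c Cc.
have Dc : Dom ([:: c], e) by split=> //= z; rewrite inE => /eqP->.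
have [hc1 _] := h_norming c.
have [a [[_ /(_ c (mem_head _ _)) /= ax] ay0]] :=
  filter_ex (filterI (UB _ Dc) (y0P _ hc1)).
have h3 : `|h c (y0 - y) : R| <= 2 * e by exact: le_trans (h_le1 _ _) (ltW y0y).
move: h3 ax ay0 => /=.
have -> : h c (x - y) = h c x - h c y :> R by exact: linearB.
have -> : h c (y0 - y) = h c y0 - h c y :> R by exact: linearB.
rewrite !ler_norml !ltr_norml -/e.
by move=> /andP[? ?] /andP[? ?] /andP[? ?]; apply/andP; split; lra.
Qed.

Lemma hull_unique S x y : hull S x -> hull S y ->
  (forall c, C S c -> h c x = h c y) -> x = y.
Proof.
move=> Sx Sy xy; apply/eqP; rewrite -subr_eq0 -normr_le0.
apply: (@hull_norm_le S); first exact: subspace_setB (hull_subspace S) Sx Sy.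
move=> c /xy hxy; have -> : h c (x - y) = h c x - h c y :> R by exact: linearB.
by rewrite hxy subrr normr0.
Qed.

(** Approximations at precision [4 * e p] form a Cauchy sequence, since their differences lie in the
    hull and are normed by the [h c]. *)
Lemma hull_proj_exists S x :
  exists y, hull S y /\ forall c, C S c -> h c y = h c x.
Proof.
have /choice[y yP] p : exists y, hull S y /\
    forall c, C S c -> `|h c (x - y) : R| <= 4 * p.+1%:R^-1.
  by have [y ? ?] := hull_approx S x p; exists y.
pose e p : R := p.+1%:R^-1.
have e0 p : 0 < e p by rewrite invr_gt0.
have ypq p q : `|y p - y q| <= 4 * e p + 4 * e q.
  apply: (@hull_norm_le S).
    by apply: subspace_setB (hull_subspace S) _ _; have [] := yP p; have [] := yP q.
  move=> c Cc; have [_ /(_ c Cc) hp] := yP p; have [_ /(_ c Cc) hq] := yP q.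
  have -> : y p - y q = (x - y q) - (x - y p).
    by rewrite opprB addrCA addrAC subrr sub0r addrC.
  have -> : h c (x - y q - (x - y p)) = h c (x - y q) - h c (x - y p) :> R.
    exact: linearB.
  by apply: le_trans (ler_normB _ _) _; rewrite addrC lerD.
have : cvg (y @ \oo).
  apply/cauchy_cvgP/cauchy_exP => d d0.
  have [N hN] : exists N, forall n, (N <= n)%N -> e n < d / 8.
    by apply: natSinv_small; rewrite divr_gt0.
  exists (y N), N => // n /= Nn; rewrite -ball_normE /=.
  apply: le_lt_trans (ypq _ _) _.
  by have := hN _ (leqnn N); have := hN _ Nn; lra.
move=> /cvg_ex[l yl]; exists l.
have yln (d : R) : 0 < d -> exists n, e n < d /\ `|l - y n| < d.
  move=> d0; have [N hN] := natSinv_small d0.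
  have /cvgrPdist_lt/(_ _ d0)[N' _ hN'] := yl.
  exists (maxn N N'); split; first by apply: hN; exact: leq_maxl.
  by apply: hN'; exact: leq_maxr.
split.
  apply: (closed_approx (@closed_closure _ _)) => d d0.
  by have [n [_ lyn]] := yln _ d0; exists (y n) => //; have [] := yP n.
move=> c Cc; apply/eqP; rewrite -subr_eq0 -normr_le0.
apply/ler_addgt0Pr => d d0; rewrite add0r.
have [n [en lyn]] := yln (d / 5) ltac:(by rewrite divr_gt0).
have [_ /(_ c Cc) hx] := yP n.
have hl : `|h c (l - y n) : R| <= d / 5 by exact: le_trans (h_le1 _ _) (ltW lyn).
have <- : h c (l - y n) - h c (x - y n) = h c l - h c x :> R.
  have -> : h c (x - y n) = h c x - h c (y n) :> R by exact: linearB.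
  have -> : h c (l - y n) = h c l - h c (y n) :> R by exact: linearB.
  by rewrite opprB addrA subrK.
apply: le_trans (ler_normB _ _) _.
have : 4 * e n <= 4 * (d / 5) by rewrite ler_wpM2l// ltW.
by move: hl hx; rewrite -/(e n); lra.
Qed.

(** Linearity follows from uniqueness: the values of the [h c] determine an element of the hull. *)
Lemma hull_proj S : exists P : {linear X -> X},
  forall x, hull S (P x) /\ forall c, C S c -> h c (P x) = h c x.
Proof.
have /choice[P PP] := hull_proj_exists S.
have lP : linear P.
  move=> a x y; apply: (@hull_unique S); first exact: (PP _).1.
    by apply: (hull_subspace S).2; exact: (PP _).1.
  move=> c Cc; rewrite (PP (a *: x + y)).2//.
  have hl u v : h c (a *: u + v) = a * h c u + h c v :> R by exact: linearP.
  by rewrite !hl (PP x).2// (PP y).2.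
pose Pl : {linear X -> X} := HB.pack P (GRing.isLinear.Build _ _ _ _ _ lP).
by exists Pl.
Qed.

End Projections.

Section ProjectionalResolution.
Variables (R : realType) (X : completeNormedModType R).

(** All properties come from the characterization of [P S x] as the element of the hull on which the
    [h c], for [c] in the generated set, agree with their values at [x]. A larger set [S'] only adds
    functionals to be matched, whence the compatibility. *)
Lemma projectional_resolution : ewc_covered X ->
  exists (I : countType) (F : I -> seq X -> X) (P : set X -> {linear X -> X}),
    [/\ forall S, subspace_set (closure (gen F S)),
        forall S x, `|P S x| <= `|x|,
        forall S x, closure (gen F S) (P S x),
        forall S x, closure (gen F S) x -> P S x = x &
        forall S S' x, S `<=` S' -> P S (P S' x) = P S x].
Proof.
move=> Xe.
have /choice[k k_ewc] p : exists k : X -> nat,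
    forall n, ewc p.+1%:R^-1 [set x | k x = n].
  by apply: Xe; rewrite invr_gt0.
have /choice[h h_norming] (x : X) := norming_functional x.
have /choice[P PP] := hull_proj k_ewc h_norming.
exists _, (skolem k h), P; split=> [S|S x|S x|S x Sx|S S' x SS'].
- exact: hull_subspace.
- apply: (@hull_norm_le _ _ k h h_norming S); first exact: (PP S x).1.
  by move=> c Cc; rewrite (PP S x).2//; exact: h_le1.
- exact: (PP S x).1.
- apply: (@hull_unique _ _ k h h_norming S) => //; first exact: (PP S x).1.
  by move=> c Cc; rewrite (PP S x).2.
- apply: (@hull_unique _ _ k h h_norming S); [exact: (PP S _).1..|].
  move=> c Cc; rewrite !(PP S _).2// (PP S' _).2//.
  exact: gen_mono Cc.
Qed.

End ProjectionalResolution.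
(** * Construction of shrinking families *)

(** The order axioms are read off minima: totality from sets of two elements, transitivity from sets
    of three, antisymmetry from the uniqueness of the minimum of a pair. *)
Lemma well_ordering (T : choiceType) : exists le : rel T,
  [/\ total le, transitive le, antisymmetric le &
    forall A : set T, A !=set0 -> exists2 z, A z & forall x, A x -> le z x].
Proof.
have [le wo] := wochoice.well_ordering_principle T; exists le.
have le_min (A : set T) : A !=set0 -> exists2 z, A z & forall x, A x -> le z x.
  move=> [a Aa]; have [|z [[zA zle] _]] := wo [pred x | `[< A x >]].
    by exists a; apply/asboolP.
  by exists z => [|x Ax]; [exact/asboolP|apply: zle; exact/asboolP].
have le_tot : total le.
  move=> x y; have [|z [->|->] zle] := le_min [set x; y]; first by exists x; left.
    by rewrite zle//; right.
  by rewrite [le y x]zle ?orbT//; left.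
have le_refl x : le x x by have := le_tot x x; rewrite orbb.
have le_anti : antisymmetric le.
  move=> x y /andP[xy yx].
  have [|z [_ zu]] := wo (pred2 x y); first by exists x; rewrite !inE eqxx.
  have mx : wochoice.minimum_of le (pred2 x y) x.
    by split; [rewrite inE eqxx|move=> u; rewrite inE => /orP[]/eqP->].
  have my : wochoice.minimum_of le (pred2 x y) y.
    by split; [rewrite inE eqxx orbT|move=> u; rewrite inE => /orP[]/eqP->].
  by rewrite -(zu _ mx) (zu _ my).
split=> // y x z xy yz.
have [|w] := le_min [set x; y; z]; first by exists x; left; left.
case=> [[->|->]|->] wle; first by apply: wle; right.
  have xE : x = y by apply: le_anti; rewrite xy wle//; left; left.
  by rewrite xE.
have yE : y = z by apply: le_anti; rewrite yz wle//; left; right.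
by rewrite -yE.
Qed.

(* For a total family this property characterizes the subspaces of WCG spaces. *)
Definition shrinking (R : realType) (X : normedModType R) (I : Type)
    (x : I -> X) :=
  forall e : R, 0 < e -> exists k : I -> nat, forall (f : dual X) n,
    `|f| <= 1 -> finite_set [set i | k i = n /\ e < `|f (x i) : R|].

(** * Decomposition along a well-ordering *)

Section LongSequences.
Variables (R : realType) (X : completeNormedModType R).
Variables (I : countType) (F : I -> seq X -> X) (P : set X -> {linear X -> X}).
Let M S := closure (gen F S).
Hypothesis M_subspace : forall S, subspace_set (M S).
Hypothesis P_le : forall S x, `|P S x| <= `|x|.
Hypothesis P_in : forall S x, M S (P S x).
Hypothesis P_id : forall S x, M S x -> P S x = x.
Hypothesis P_P : forall S S' x, S `<=` S' -> P S (P S' x) = P S x.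
Variable le : rel X.
Hypotheses (le_tot : total le) (le_tr : transitive le).
Hypothesis le_anti : antisymmetric le.
Hypothesis le_wf : forall A : set X, A !=set0 ->
  exists2 z, A z & forall x, A x -> le z x.

Let below t := [set v | ~~ le t v].
Let upto t := [set v | le v t].

Let below_upto t : below t `<=` upto t.
Proof. by move=> v; rewrite /below /upto /=; have := le_tot t v; case: (le t v). Qed.

Let upto_below u t : below t u -> upto u `<=` below t.
Proof.
rewrite /below /upto /= => tu v vu; apply/negP => tv.
by move/negP: tu; apply; exact: le_tr vu.
Qed.

Let upto_sub t : upto t `<=` below t `|` [set t].
Proof.
rewrite /below /upto => v /= vt; have [tv|] := boolP (le t v); last by left.
by right; apply: le_anti; rewrite vt tv.
Qed.

Let M_mono S S' : S `<=` S' -> M S `<=` M S'.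
Proof. by move=> SS'; apply: closure_subset; exact: gen_mono. Qed.

(** [D] lies below the least point that has infinitely many elements of [J] below it, or is
    everything if there is no such point. Within [D], the set [J] is cofinal and of order type
    omega. *)
Lemma infinite_segment (J : set X) : infinite_set J -> exists D : set X,
  [/\ forall u v, D v -> le u v -> D u,
      infinite_set (J `&` D) & forall u, D u -> finite_set (J `&` upto u)].
Proof.
move=> Jinf.
have segfin D : (forall u, D u -> finite_set (J `&` below u)) ->
    forall u, D u -> finite_set (J `&` upto u).
  move=> Dfin u Du; apply: sub_finite_set (_ : _ `<=` (J `&` below u) `|` [set u]) _.
    by move=> v [Jv /upto_sub[uv|->]]; [left|right].
  by rewrite finite_setU; split; [exact: Dfin|exact: finite_set1].
have [[u ui]|fin] := pselect (exists u, infinite_set (J `&` below u)).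
  have [|z zi zmin] := le_wf (A := [set u | infinite_set (J `&` below u)]).
    by exists u.
  exists (below z); split=> //.
    by move=> v w zw vw; apply: (upto_below zw).
  apply: segfin => w zw; apply: contrapT => wi.
  by move/negP: zw; apply; exact: zmin.
exists setT; split=> //; first by rewrite setIT.
by apply: segfin => u _; apply: contrapT => ui; apply: fin; exists u.
Qed.

(* The weak* cluster points of a long sequence of vectors z_t, each one in
   the kernel of the previous projections, are small if they are close to X. *)
Lemma no_long_sequence (s J : set X) (z : X -> X) (A : set X) (e : R) (f : dual X) :
  0 < e -> ewc (e / 4) A -> `|f| <= 1 -> infinite_set J ->
  (forall t, J t -> A (z t)) ->
  (forall t, J t -> M (upto t `|` s) (z t)) ->
  (forall t, J t -> P (below t `|` s) (z t) = 0) ->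
  (forall t, J t -> e < `|f (z t) : R|) -> False.
Proof.
move=> e0 Ae f1 Jinf JA JM JP Jf.
have [D [Dlow JDinf Dfin]] := infinite_segment Jinf.
(* Along [U], the index [t] leaves every segment [upto u] with [u] in [D]. *)
have [U [UU UJD Ufin]] := cofinite_ultra JDinf.
have Uup u : D u -> U (~` upto u).
  move=> Du; apply: filterS (filterI UJD (Ufin _ (Dfin _ Du))) => t [[Jt _] nJt] ut.
  exact: nJt.
have UA : U (z @^-1` A) by apply: filterS UJD => t [Jt _]; exact: JA.
have [y yP'] := Ae (z @ U) (ultra_fmap z UU) UA.
have yP (g : dual X) : `|g| <= 1 -> U [set t | `|g (z t) - g y : R| <= e / 4].
  exact: yP'.
pose PD := P (D `|` s).
have sub_upto u : D u -> upto u `|` s `<=` D `|` s.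
  by move=> Du v [vu|sv]; [left; exact: Dlow Du vu|right].
(* For [t] above [u], the projection for [u] annihilates [z t], as it factors through the one for
   [below t]. So it nearly annihilates [y]. *)
have Pu u : D u -> `|P (upto u `|` s) y| <= e / 4.
  move=> Du; have [g [g1 gP]] := norming_functional (P (upto u `|` s) y).
  have [|g' [g'1 g'E]] := @dual_comp _ _ _ (P (upto u `|` s)) 1 g ler01 _ g1.
    by move=> x; rewrite mul1r.
  have [t [[[Jt _] ut] /=]] := filter_ex (filterI (filterI UJD (Uup _ Du)) (yP _ g'1)).
  rewrite !g'E gP.
  have -> : P (upto u `|` s) (z t) = 0.
    rewrite -(@P_P _ (below t `|` s)) ?JP ?linear0//.
    move=> v [vu|sv]; [left|by right]; apply: upto_below vu.
    by apply/negP => tu; apply: ut.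
  by rewrite linear0 sub0r normrN normr_id.
(* [PD y] is approximated by elements of hulls of segments [upto u], so the bound for these segments
   passes to it. *)
have PDy : `|PD y| <= e / 4.
  apply/ler_addgt0Pr => d d0.
  have d2 : 0 < d / 2 by rewrite divr_gt0.
  have /closure_normP/(_ _ d2)[c Cc yc] := @P_in (D `|` s) y.
  have [u Du Mc] : exists2 u, D u & M (upto u `|` s) c.
    have [sc|[u Du uc]] := gen_finitary le_tot le_tr Cc.
      have [u [_ Du]] : J `&` D !=set0 by exact: infinite_setN0.
      by exists u => //; apply: (@M_mono s) => [v sv|]; [right|exact: subset_closure].
    by exists u => //; exact: subset_closure.
  have h1 : `|P (upto u `|` s) (PD y - c)| <= d / 2.
    by apply: le_trans (P_le _ _) _; exact: ltW.
  move: h1; rewrite linearB /= P_P ?(P_id Mc)//; last exact: sub_upto.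
  move=> h1; have := Pu _ Du.
  have -> : PD y = (PD y - c) + (P (upto u `|` s) y - (P (upto u `|` s) y - c)).
    by rewrite opprB [X in _ + X]addrC subrK subrK.
  move=> h2; apply: le_trans (ler_normD _ _) _.
  have := ler_normB (P (upto u `|` s) y) (P (upto u `|` s) y - c).
  by move: yc h1 h2; rewrite -/(PD y); lra.
have [|g' [g'1 g'E]] := @dual_comp _ _ _ PD 1 f ler01 _ f1.
  by move=> x; rewrite mul1r; exact: P_le.
have [t [[Jt Dt] /=]] := filter_ex (filterI UJD (yP _ g'1)).
rewrite !g'E.
have -> : PD (z t) = z t by apply: P_id; apply: M_mono (JM _ Jt); exact: sub_upto.
move=> h1; have := Jf _ Jt; apply/negP; rewrite -leNgt.
have h2 : `|f (PD y) : R| <= e / 4 by exact: le_trans (dual_le1 _ f1) PDy.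
have -> : f (z t) = (f (z t) - f (PD y)) + f (PD y) :> R by rewrite subrK.
apply: le_trans (ler_normD _ _) _.
by move: h1 h2; lra.
Qed.

Hypothesis X_ewc : ewc_covered X.

(** The index type is packed with the family, so that one family can be chosen for each [t]. *)
Definition shrinking_spanned (A : set X) := exists fam : {J : Type & J -> X},
  shrinking (projT2 fam) /\ A `<=` cspan (range (projT2 fam)).

(* Allowing for finitely many further generators makes the transfinite
   induction on D possible without any cardinal arithmetic. *)
Let good (D : set X) :=
  forall s : seq X, shrinking_spanned (M (D `|` [set x | x \in s])).

Let Q (s : seq X) t : {linear X -> X} :=
  P (upto t `|` [set x | x \in s]) \- P (below t `|` [set x | x \in s]).

(** The new family consists of the countable set generated by [s] and, for [t] in [D], of the images
    under the difference [Q s t] of a family for the hull of [upto t] and [s]. The latter exists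
    because [below t] is good and [t] can be added to the list. *)
Lemma good_step (D : set X) : (forall u v, D v -> le u v -> D u) ->
  (forall t, D t -> good (below t)) -> good D.
Proof.
move=> Dlow Dgood s; set S0 := [set x | x \in s].
have /choice[fam famP] t : exists fam : {J : Type & J -> X},
    shrinking (projT2 fam) /\
    (D t -> M (upto t `|` S0) `<=` cspan (range (projT2 fam))) /\
    (~ D t -> projT1 fam -> False).
  have [Dt|nDt] := pselect (D t).
    have [fam [fs fM]] := Dgood t Dt (t :: s).
    exists fam; split=> //; split=> // _ x Mx; apply: fM; apply: M_mono Mx.
    move=> v [/upto_sub[|->]|sv]; [by left|right..].
      by rewrite /= mem_head.
    by rewrite /= inE (sv : v \in s) orbT.
  exists (existT (fun J : Type => J -> X) void (of_void X)); split=> //= e e0.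
  exists (of_void nat) => f n _.
  by apply: sub_finite_set (finite_set0 _) => -[].
have [e0 e0P] := gen_countable F 0 s.
pose J := (nat + {t : X & projT1 (fam t)})%type.
pose y (i : J) := match i with
  | inl n => e0 n
  | inr (existT t i) => Q s t (projT2 (fam t) i) end.
have Q2 t x : `|Q s t x| <= 2 * `|x|.
  apply: le_trans (ler_normB _ _) _; rewrite mulr_natl mulr2n.
  by apply: lerD; exact: P_le.
exists (existT _ J y); split => /=; last first.
  set V := cspan (range y).
  have Vs : subspace_set V by exact: cspan_subspace.
  have MV S : gen F S `<=` V -> M S `<=` V.
    move=> SV; apply: subset_trans (closure_subset SV) _.
    by rewrite /V /cspan -(closure_id _).1//; exact: closed_closure.
  have fin (D' : set X) : (forall t, D' t -> M (upto t `|` S0) `<=` V) ->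
      M (D' `|` S0) `<=` V.
    move=> D'V; apply: MV => x /(gen_finitary le_tot le_tr)[sx|[u D'u ux]].
      have [n _ <-] := e0P _ sx.
      by apply: sub_cspan; exists (inl n).
    by apply: (D'V u) => //; exact: subset_closure.
  (* At the least [t] whose hull escapes [V], split [x] into its projection to the hull below [t]
     and its component under [Q s t]. *)
  apply: (fin D) => t0 Dt0; apply: contrapT => nV.
  have [|t [Dt tV] tmin] :=
    le_wf (A := [set t | D t /\ ~ (M (upto t `|` S0) `<=` V)]).
    by exists t0.
  apply: tV => x Mx; have -> : x = P (below t `|` S0) x + Q s t x.
    by rewrite /= /Q addrC subrK P_id.
  apply: (subspace_setD Vs).
    apply: (fin (below t) _ _ (@P_in _ x)) => u tu; apply: contrapT => uV.
    move/negP: (tu); apply; apply: tmin; split=> //.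
    by apply: Dlow Dt _; exact: below_upto.
  have [_ [/(_ Dt) famV _]] := famP t.
  apply: cspan_image_sub (Q2 t) _ _ (famV _ Mx) => _ [i _ <-].
  by apply: sub_cspan; exists (inr (existT _ t i)).
move=> e e_gt0.
have [k kP] := X_ewc (divr_gt0 e_gt0 (ltr0Sn R 3)).
(* Half of [e], because [Q s t] may double norms. *)
have ktex t : exists k : projT1 (fam t) -> nat, forall (f : dual X) n,
    `|f| <= 1 -> finite_set [set i | k i = n /\ e / 2 < `|f (projT2 (fam t) i) : R|].
  by have [+ _] := famP t; apply; rewrite divr_gt0.
pose kt t := sval (cid (ktex t)); have ktP t := svalP (cid (ktex t)).
(* A class of indices fixes the piece inside the family of [t] and the almost weakly compact piece
   of the vector. Each [inl n] is alone in its class. *)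
pose code (i : J) : nat + nat * nat := match i with
  | inl n => inl n
  | inr (existT t i) => inr (kt t i, k (Q s t (projT2 (fam t) i))) end.
exists (pickle \o code) => f n f1.
set T := [set i | _].
have Tcode i j : T i -> T j -> code i = code j.
  by move=> [iT _] [jT _]; apply: (pcan_inj pickleK); rewrite [LHS]iT [RHS]jT.
apply: contrapT => Tinf.
have [j0 Tj0] := infinite_setN0 Tinf.
case: j0 Tj0 => [m|[t0 i0]] Tj0.
  apply: Tinf; apply: sub_finite_set (finite_set1 (inl m)) => -[m'|[t i]] Ti.
    by have [->] := Tcode _ _ Ti Tj0.
  by have := Tcode _ _ Ti Tj0.
pose J' := [set t | exists i, T (inr (existT _ t i))].
have Tsub : T `<=` \bigcup_(t in J') [set inr (existT _ t i) | i in
    [set i | T (inr (existT _ t i))]].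
  case=> [m'|[t i]] Ti; first by have := Tcode _ _ Ti Tj0.
  by exists t; [exists i|exists i].
(* Each [t] contributes only finitely many indices of a class, so infinitely many [t] occur; one
   vector for each of them gives a long sequence. *)
have J'inf : infinite_set J'.
  move=> J'fin; apply: Tinf; apply: sub_finite_set Tsub _.
  apply: bigcup_finite => // t _; apply: finite_image.
  have [|g [g1 gE]] := @dual_comp _ _ _ (Q s t) 2 f _ (Q2 t) f1.
    by rewrite ler0n.
  have g21 : `|2^-1 *: g| <= 1.
    by rewrite normrZ ger0_norm ?invr_ge0// ler_pdivrMl// mulr1.
  apply: sub_finite_set (ktP t _ (kt t0 i0) g21) => i Ti /=.
  split; first by have [] := Tcode _ _ Ti Tj0.
  have [_ eT] := Ti.
  have -> : `|(2^-1 *: g) (projT2 (fam t) i) : R| =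
      2^-1 * `|f (Q s t (projT2 (fam t) i)) : R|.
    by rewrite -gE -[2^-1 in RHS]ger0_norm ?invr_ge0// -normrM.
  by rewrite mulrC ltr_pM2l ?invr_gt0.
have /choice[i iP] t : exists x : X, J' t ->
    exists2 i, x = Q s t (projT2 (fam t) i) & T (inr (existT _ t i)).
  have [[i Ti]|nJ] := pselect (J' t); last by exists 0.
  by exists (Q s t (projT2 (fam t) i)) => _; exists i.
apply: (@no_long_sequence S0 J' i _ e f e_gt0 (kP (k (i t0))) f1 J'inf).
- move=> t /iP[j -> Tj] /=.
  have [|j0 -> Tj0'] := iP t0; first by exists i0.
  by have [_] := Tcode _ _ Tj Tj0'.
- move=> t /iP[j -> Tj] /=; apply: (subspace_setB (M_subspace _)).
    exact: P_in.
  apply: (@M_mono (below t `|` S0)); last exact: P_in.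
  by apply: setSU; exact: below_upto.
- move=> t /iP[j -> Tj] /=; rewrite /Q linearB /= !P_P ?subrr//.
  by apply: setSU; exact: below_upto.
- by move=> t /iP[j -> [_]].
Qed.

Lemma shrinking_total : exists fam : {J : Type & J -> X},
  shrinking (projT2 fam) /\ cspan (range (projT2 fam)) = setT.
Proof.
have gT : good setT.
  apply: good_step => // t0 _; apply: contrapT => nt0.
  have [|t nt tmin] := le_wf (A := [set t | ~ good (below t)]); first by exists t0.
  apply: nt; apply: good_step => [u v tv uv|u tu].
    exact: (upto_below tv).
  by apply: contrapT => /tmin; apply/negP.
have [fam [fs fM]] := gT [::]; exists fam; split=> //.
apply/seteqP; split=> // x _; apply: fM.
by apply: subset_closure; apply: gen_in; left.
Qed.

End LongSequences.

Lemma ewc_covered_shrinking (R : realType) (X : completeNormedModType R) :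
  ewc_covered X -> exists (J : Type) (x : J -> X),
    [/\ shrinking x, forall i, `|x i| <= 1 & cspan (range x) = setT].
Proof.
move=> Xe.
have [I [F [P [M_sub P_le P_in P_id P_P]]]] := projectional_resolution Xe.
have [le [le_tot le_tr le_anti le_wf]] := well_ordering X.
have [[J x] [/= xs xT]] :=
  shrinking_total M_sub P_le P_in P_id P_P le_tot le_tr le_anti le_wf Xe.
(* Adding 1 keeps the factor nonzero and at most 1, also where [x i] is 0. *)
pose c i : R := (`|x i| + 1)^-1.
have c0 i : 0 < `|x i| + 1 by rewrite ltr_wpDl.
have c1 i : `|c i| <= 1.
  by rewrite /c ger0_norm ?invr_ge0 ?(ltW (c0 i))// invf_le1// lerDr.
exists J, (fun i => c i *: x i); split.
- move=> e e0; have [k kP] := xs e e0; exists k => f n f1.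
  apply: sub_finite_set (kP f n f1) => i /= [ki ei]; split=> //.
  apply: lt_le_trans ei _; have -> : f (c i *: x i) = c i * f (x i) :> R.
    exact: linearZ.
  by rewrite normrM ler_piMl.
- move=> i; rewrite normrZ ger0_norm ?invr_ge0 ?(ltW (c0 i))//.
  by rewrite ler_pdivrMl// mulr1 lerDl.
- apply/seteqP; split=> // z _; have : cspan (range x) z by rewrite xT.
  have id1 (u : X) : `|(idfun : {linear X -> X}) u| <= 1 * `|u| by rewrite mul1r.
  apply: (cspan_image_sub id1) => _ [i _ <-] /=.
  have -> : x i = (c i)^-1 *: (c i *: x i).
    by rewrite scalerA mulVf ?scale1r// invr_eq0 gt_eqF.
  apply: (subspace_setZ _ (cspan_subspace _)).
  by apply: sub_cspan; exists i.
Qed.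
(** * Weakly null families of bounded functions *)

Section BoundedFunctions.
Variables (R : realType) (T : Type).

Definition is_bfun : {pred T -> R^o} :=
  fun u => `[< exists C : R, forall t, `|u t : R| <= C >].

Lemma is_bfun_submod_closed : submod_closed is_bfun.
Proof.
split; first by apply/asboolP; exists 0 => t; rewrite normr0.
move=> a u v /asboolP[C uC] /asboolP[D vD]; apply/asboolP.
exists (`|a| * C + D) => t; apply: le_trans (ler_normD _ _) _.
by apply: lerD => //; rewrite normrM ler_wpM2l.
Qed.

HB.instance Definition _ :=
  GRing.isSubmodClosed.Build R (T -> R^o) is_bfun is_bfun_submod_closed.

Record bfun := Bfun { bfun_fun :> T -> R^o; bfun_prop : bfun_fun \in is_bfun }.

HB.instance Definition _ := [isSub for bfun_fun].
HB.instance Definition _ := [Choice of bfun by <:].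
HB.instance Definition _ := [SubChoice_isSubLmodule of bfun by <:].

(* The element 0 is there for the case of an empty T. *)
Definition bfun_norm (u : bfun) : R :=
  sup [set r : R | r = 0 \/ exists t, r = `|u t|].

Lemma bfun_has_sup (u : bfun) : has_sup [set r : R | r = 0 \/ exists t, r = `|u t|].
Proof.
split; first by exists 0; left.
have /asboolP[C uC] := bfun_prop u; exists (Num.max 0 C) => _ [->|[t ->]].
  by rewrite le_max lexx.
by rewrite le_max uC orbT.
Qed.

Lemma bfun_norm_ge (u : bfun) t : `|u t : R| <= bfun_norm u.
Proof.
by apply: ub_le_sup; [exact: (bfun_has_sup u).2|right; exists t].
Qed.

Lemma bfun_norm_ge0 (u : bfun) : 0 <= bfun_norm u.
Proof. by apply: ub_le_sup; [exact: (bfun_has_sup u).2|left]. Qed.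

Lemma bfun_norm_le (u : bfun) C :
  0 <= C -> (forall t, `|u t : R| <= C) -> bfun_norm u <= C.
Proof.
move=> C0 uC; apply: ge_sup; first exact: (bfun_has_sup u).1.
by move=> _ [->//|[t ->]].
Qed.

Lemma bfun_normD (u v : bfun) : bfun_norm (u + v) <= bfun_norm u + bfun_norm v.
Proof.
apply: bfun_norm_le => [|t]; first by rewrite addr_ge0 ?bfun_norm_ge0.
apply: le_trans (ler_normD (u t) (v t)) _.
by apply: lerD; exact: bfun_norm_ge.
Qed.

Lemma bfun_normZ (a : R) (u : bfun) : bfun_norm (a *: u) = `|a| * bfun_norm u.
Proof.
have le b v : bfun_norm (b *: v) <= `|b| * bfun_norm v.
  apply: bfun_norm_le => [|t]; first by rewrite mulr_ge0 ?bfun_norm_ge0.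
  rewrite [X in `|X|](_ : _ = b * v t)// normrM.
  by rewrite ler_wpM2l// bfun_norm_ge.
apply/le_anti; rewrite le/=.
have [->|a0] := eqVneq a 0; first by rewrite normr0 mul0r bfun_norm_ge0.
have na : 0 < `|a| by rewrite normr_gt0.
rewrite -ler_pdivlMl// -normfV; apply: le_trans (le _ _).
by rewrite scalerA mulVf// scale1r.
Qed.

Lemma bfun_norm0_eq0 (u : bfun) : bfun_norm u = 0 -> u = 0.
Proof.
move=> u0; apply/val_inj/funext => t /=; apply/eqP; rewrite -normr_le0.
by rewrite -[leRHS]u0; exact: bfun_norm_ge.
Qed.

HB.instance Definition _ :=
  Lmodule_isNormed.Build R bfun bfun_normD bfun_normZ bfun_norm0_eq0.

Lemma bfun_le1 (u : bfun) : (forall t, `|u t : R| <= 1) -> `|u| <= 1.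
Proof. by move=> u1; apply: bfun_norm_le. Qed.

Lemma exists_bfun (g : T -> R) (C : R) :
  (forall t, `|g t| <= C) -> exists u : bfun, forall t, u t = g t.
Proof.
move=> gC; have gb : (g : T -> R^o) \in is_bfun by apply/asboolP; exists C.
by exists (Bfun gb).
Qed.

End BoundedFunctions.

(** * Total variation of functionals on bounded functions *)

Section TotalVariation.
Variables (R : realType) (T : Type) (L : dual (bfun R T)).
Implicit Types (A B : set T) (g : bfun R T).

Let tv_set A := [set (L g : R) | g in [set g : bfun R T |
  (forall t, `|g t : R| <= 1) /\ forall t, ~ A t -> g t = 0]].

(** With [L] seen as a finitely additive signed measure on all subsets of [T], this is its total
    variation on [A]. *)
Definition tv A : R := sup (tv_set A).

Let tv_has_sup A : has_sup (tv_set A).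
Proof.
split; first by exists (L 0), 0 => //; split=> // t; rewrite normr0 ler01.
exists `|L| => _ [g [g1 _] <-]; apply: le_trans (ler_norm _) _.
apply: le_trans (dual_normP L g) _.
by apply: ler_piMr; [exact: dual_norm_ge0|exact: bfun_le1].
Qed.

Lemma tv_ge A g : (forall t, `|g t : R| <= 1) ->
  (forall t, ~ A t -> g t = 0) -> L g <= tv A.
Proof. by move=> g1 gA; apply: ub_le_sup; [exact: (tv_has_sup A).2|exists g]. Qed.

Lemma tv_le A (C : R) : (forall g, (forall t, `|g t : R| <= 1) ->
  (forall t, ~ A t -> g t = 0) -> L g <= C) -> tv A <= C.
Proof.
move=> AC; apply: ge_sup; first exact: (tv_has_sup A).1.
by move=> _ [g [g1 gA] <-]; exact: AC.
Qed.

Lemma tv_norm_ge A g : (forall t, `|g t : R| <= 1) ->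
  (forall t, ~ A t -> g t = 0) -> `|L g : R| <= tv A.
Proof.
move=> g1 gA; rewrite ler_norml lerNl tv_ge// andbT -linearN tv_ge// => t.
  by rewrite [X in `|X|](_ : _ = - g t)// normrN.
by move=> /gA; rewrite [X in _ -> X = 0](_ : _ = - g t)// => ->; rewrite oppr0.
Qed.

Lemma tv_le_norm A : tv A <= `|L|.
Proof.
apply: tv_le => g g1 _; apply: le_trans (ler_norm _) _.
apply: le_trans (dual_normP L g) _.
by apply: ler_piMr; [exact: dual_norm_ge0|exact: bfun_le1].
Qed.

Lemma tv0 : tv set0 = 0.
Proof.
apply/le_anti/andP; split.
  apply: tv_le => g _ g0; have -> : g = 0 by apply/val_inj/funext => t; exact: g0.
  by rewrite linear0.
by rewrite -[leLHS](linear0 L); apply: tv_ge => // t; rewrite normr0 ler01.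
Qed.

Lemma tv_mono A B : A `<=` B -> tv A <= tv B.
Proof.
move=> AB; apply: tv_le => g g1 gA; apply: tv_ge => // t nB.
by apply: gA => /AB.
Qed.

Lemma tv_split A B : tv A <= tv (A `&` B) + tv (A `\` B).
Proof.
apply: tv_le => g g1 gA.
have part (b : T -> bool) : exists u : bfun R T, forall t,
    u t = if b t then g t : R else 0.
  apply: (@exists_bfun R T _ 1) => t; case: ifP => // _.
  by rewrite normr0 ler01.
have [u uE] := part (fun t => `[< B t >]).
have [v vE] := part (fun t => ~~ `[< B t >]).
have -> : g = u + v.
  apply/val_inj/funext => t; rewrite [RHS](_ : _ = u t + v t)// uE vE.
  by case: asboolP => _ /=; rewrite ?addr0 ?add0r.
rewrite linearD; apply: lerD; apply: tv_ge => t; rewrite ?uE ?vE.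
- by case: ifP => // _; rewrite ?normr0 ?ler01.
- by case: asboolP => // Bt nAB; apply: gA => At; apply: nAB.
- by case: ifP => // _; rewrite ?normr0 ?ler01.
- by case: asboolP => // Bt nAB; apply: gA => At; apply: nAB.
Qed.

Lemma tvU_le A B : tv (A `|` B) <= tv A + tv B.
Proof.
apply: le_trans (tv_split _ A) _; apply: lerD; apply: tv_mono => t.
  by case.
by case=> -[].
Qed.

(** The sum of two test functions with disjoint supports is still bounded by 1. *)
Lemma tv_disjoint A B : A `&` B = set0 -> tv A + tv B <= tv (A `|` B).
Proof.
move=> AB0; rewrite -lerBrDr; apply: tv_le => u u1 uA.
rewrite lerBrDr -lerBrDl; apply: tv_le => v v1 vB.
have uv t : u t = 0 \/ v t = 0.
  have [At|/uA] := pselect (A t); last by left.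
  right; apply: vB => Bt.
  by have : (A `&` B) t by []; rewrite AB0.
rewrite lerBrDl -linearD; apply: tv_ge => t.
  rewrite [X in `|X|](_ : _ = u t + v t)//.
  by have [->|->] := uv t; rewrite ?addr0 ?add0r.
move=> nAB; rewrite [LHS](_ : _ = u t + v t)//.
by rewrite uA ?vB ?addr0// => ?; apply: nAB; [right|left].
Qed.

End TotalVariation.
Section Intersections.
Variables (R : realType) (T : Type) (L : dual (bfun R T)).
Variables (I : choiceType) (U : I -> set T).

(* Gillis's lemma: too many sets of total variation at least d with small
   pairwise intersections would exceed the norm of L. *)
Lemma tv_big_step (F : set_system I) (V : set T) (d : R) :
  UltraFilter F -> 0 < d -> F [set i | d <= tv L (V `&` U i)] ->
  F [set i | exists2 d', 0 < d' & F [set j | d' <= tv L (V `&` U i `&` U j)]].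
Proof.
move=> FU d0 Fd; set G := [set i | _].
have [//|FnG] := in_ultra_setVsetC G FU; exfalso.
(* [N] contributions of [d / 2] exceed the norm of [L]. *)
pose N := (Num.Def.truncn (`|L| / (d / 2))).+1.
have N0 : 0 < N%:R :> R by rewrite ltr0n.
have LN : `|L| < N%:R * (d / 2).
  by rewrite -ltr_pdivrMr ?divr_gt0//; exact: Num.Theory.truncnS_gt.
(* At most [N] overlaps of size [d'] cost at most [d / 2], so a further set of variation at least
   [d] still contributes [d / 2]. *)
pose d' := d / 2 / N%:R.
have d'0 : 0 < d' by rewrite !divr_gt0.
have small i : ~ G i -> F [set j | tv L (V `&` U i `&` U j) <= d'].
  move=> nGi.
  have [Fj|Fj] := in_ultra_setVsetC [set j | d' <= tv L (V `&` U i `&` U j)] FU.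
    by exfalso; apply: nGi; exists d'.
  by apply: filterS Fj => j /=; rewrite leNgt => /negP; rewrite negbK => /ltW.
(* [A] accumulates [k] of the sets and, for almost all [j] along [F], meets the next candidate in
   small variation. *)
suff step (k : nat) : (k <= N)%N -> exists A : set T,
    k%:R * (d / 2) <= tv L A /\
    F [set j | tv L (A `&` V `&` U j) <= k%:R * d'].
  have [A [NA _]] := step N (leqnn N).
  by have := le_lt_trans (le_trans NA (tv_le_norm L A)) LN; rewrite ltxx.
elim: k => [_|k IHk kN].
  exists set0; rewrite tv0 mul0r; split=> //.
  by apply: filterS filterT => j _ /=; rewrite !set0I tv0 mul0r.
have [A [kA FA]] := IHk (ltnW kN).
have [i [[/= nGi Vi] Ai]] := filter_ex (filterI (filterI FnG Fd) FA).
have kd : k%:R * d' <= d / 2.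
  rewrite /d' mulrCA ger_pMr ?divr_gt0// ler_pdivrMr// mul1r.
  by rewrite ler_nat ltnW.
exists (A `|` (V `&` U i `\` A)); split.
  apply: le_trans (tv_disjoint L _); last first.
    by apply/seteqP; split=> t // [At [_ /(_ At)]].
  have := tv_split L (V `&` U i) A.
  rewrite [V `&` U i `&` A](_ : _ = A `&` V `&` U i); last first.
    by rewrite setIC setIA.
  move=> h; rewrite -natr1 mulrDl mul1r.
  by move: h kA Vi Ai kd; lra.
apply: filterS (filterI FA (small i nGi)) => j [/= Aj Vij].
rewrite -natr1 mulrDl mul1r; apply: le_trans (lerD Aj Vij).
apply: le_trans (tvU_le _ _ _); apply: tv_mono => t.
move=> [[[At|[[Vt Ut] _]] Vt'] Ujt]; first by left.
by right.
Qed.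

(** Iterating [tv_big_step] keeps the variation of the finite intersections positive, so they are
    nonempty. *)
Lemma tv_intersections (J : set I) (e : R) : 0 < e -> infinite_set J ->
  (forall i, J i -> e <= tv L (U i)) ->
  exists (i : nat -> I) (t : nat -> T),
    [/\ injective i, forall k, J (i k) &
        forall j k, (j <= k)%N -> U (i j) (t k)].
Proof.
move=> e0 Jinf Je; have [F [FU FJ Ffin]] := cofinite_ultra Jinf.
pose V (s : seq I) := [set t | forall i, i \in s -> U i t].
pose big s := exists2 d, 0 < d & F [set j | d <= tv L (V s `&` U j)].
have VS s i : V s `&` U i = V (i :: s).
  apply/seteqP; split=> t.
    by move=> [Vt Ut] j; rewrite inE => /predU1P[->//|]; exact: Vt.
  move=> Vt; split; last by apply: Vt; exact: mem_head.
  by move=> j js; apply: Vt; rewrite inE js orbT.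
have /choice[next nextP] (s : seq I) : exists i : I, big s ->
    [/\ big (i :: s), J i & i \notin s].
  have [[d d0 sd]|nb] := pselect (big s); last first.
    by have [i _] := infinite_setN0 Jinf; exists i.
  have Fs : F (~` [set` s]) by apply: Ffin; exact: finite_seq.
  have [i [[Ji si] [d' d'0 id]]] :=
    filter_ex (filterI (filterI FJ Fs) (tv_big_step FU d0 sd)).
  exists i => _; split=> //; last exact/negP.
  by exists d' => //; apply: filterS id => j /=; rewrite VS.
pose s := fix s k := if k is k'.+1 then next (s k') :: s k' else [::].
have sbig k : big (s k).
  elim: k => [|k IHk]; last by have [] := nextP _ IHk.
  exists e => //; apply: filterS FJ => j Jj /=.
  by rewrite (_ : V [::] = setT) ?setTI ?Je//; apply/seteqP.
have smem j k : (j < k)%N -> next (s j) \in s k.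
  elim: k => // k IHk; rewrite ltnS leq_eqVlt => /predU1P[->|/IHk jk].
    exact: mem_head.
  by rewrite inE jk orbT.
have Vn0 k : exists t, V (s k) t.
  have [d d0 kd] := sbig k; have [i /= di] := filter_ex kd.
  apply: contrapT => V0; move: di; rewrite (_ : V (s k) = set0) ?set0I ?tv0.
    by rewrite leNgt d0.
  by apply/seteqP; split=> // t Vt; case: V0; exists t.
(* [s k.+1] contains the index number [k] as well, which the case [j = k] requires. *)
have /choice[t tP] k := Vn0 k.+1.
exists (next \o s), t; split.
- move=> j k /= jk; apply/eqP; rewrite -[_ == _]negbK neq_ltn; apply/negP.
  have nm l : next (s l) \notin s l by have [] := nextP _ (sbig l).
  case/orP => /smem; first by rewrite jk (negPf (nm k)).
  by rewrite -jk (negPf (nm j)).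
- by move=> k; have [] := nextP _ (sbig k).
- by move=> j k jk; apply: (tP k); apply: smem.
Qed.

End Intersections.

(** * Weak convergence and weak compactness *)

Section WeakCompactness.
Variable R : realType.

(** Weak* compactness of the dual ball, in the form of pointwise limits along an ultrafilter. *)
Lemma dual_ultralimit (X : normedModType R) (S : Type) (F : set_system S)
    (g : S -> dual X) : UltraFilter F -> (forall s, `|g s| <= 1) ->
  exists f : dual X, `|f| <= 1 /\ forall x, (fun s => g s x : R) @ F --> (f x : R).
Proof.
move=> FU g1.
have /choice[f fP] (x : X) : exists l : R, (fun s => g s x : R) @ F --> l.
  apply: (bounded_ultra_cvg (M := `|x|)).
  by apply: filterS filterT => s _ /=; exact: dual_le1.
have fl : linear (f : X -> R^o).
  move=> a x y; apply: (cvg_unique _ (fP (a *: x + y))) => //.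
  have -> : (fun s => g s (a *: x + y) : R) = (fun s => a * g s x + g s y).
    by apply/funext => s; exact: linearP.
  by apply: cvgD (fP y); apply: cvgM (fP x); exact: cvg_cst.
pose fL : {linear X -> R^o} := HB.pack (f : X -> R^o)
    (GRing.isLinear.Build _ _ _ _ _ fl).
have [|G [G1 GE]] := @bounded_dual _ _ fL 1 ler01.
  move=> x; rewrite mul1r /=.
  have h : (fun s => `|g s x : R|) @ F --> `|f x| by exact: cvg_norm (fP x).
  apply: (@cvgr_to_le _ F _ _ (fun s => `|g s x : R|)) h _.
  by apply: nearW => s /=; exact: dual_le1.
by exists G; split=> // x; rewrite GE; exact: fP.
Qed.

Lemma weak_cvgP (W : normedModType R) (F : set_system W) (p : W) : Filter F ->
  (forall L : dual W, (fun w => L w : R) @ F --> (L p : R)) -> F --> (p : weak W).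
Proof.
move=> FF FL A /= [_ [[B Bop <-] Bp BA]].
pose phi := (fun (x : W) => (fun f => f x) : {ptws dual W -> R^o}).
have : phi @ F --> phi p by apply/pointwise_cvgP => L; exact: FL.
have nB : nbhs (phi p) B by rewrite nbhsE; exists B.
by move=> /(_ B nB) FB; apply: filterS BA _; exact: FB.
Qed.

(** An ultrafilter on this set is principal or converges weakly to 0: if it is not principal, it
    avoids the finitely many points at which a given functional is large. *)
Lemma weakly_compact_c0 (W : normedModType R) (I : Type) (g : I -> W) :
  (forall (L : dual W) (e : R), 0 < e ->
    finite_set [set i | e < `|L (g i) : R|]) ->
  weakly_compact [set w | w = 0 \/ exists i, w = g i].
Proof.
move=> gc0; set G := [set w | _]; rewrite /weakly_compact compact_ultra => F FU FG.
have [[w [Gw Fw]]|nF] := pselect (exists w, G w /\ F [set w]).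
  exists w; split=> // A /nbhs_singleton Aw.
  by apply: filterS Fw => _ ->.
exists 0; split; first by left.
apply: weak_cvgP => L; rewrite linear0; apply/cvgrPdist_le => e e0.
have [FL|FL] := in_ultra_setVsetC [set w : W | `|L w : R| <= e] FU.
  by apply: filterS FL => w /=; rewrite sub0r normrN.
exfalso; apply: nF.
have := finite_ultra FU (finite_image g (gc0 L e e0)).
case=> [|_ [i _ <-] Fi]; last by exists (g i); split=> //; right; exists i.
apply: filterS (filterI FG FL) => w [[->|[i ->]]] /=.
  by rewrite linear0 normr0 (ltW e0).
by move=> /negP; rewrite -ltNge => ei; exists i.
Qed.

End WeakCompactness.
(** * WCG superspaces *)

Section ClosedSpan.
Variables (R : realType) (V : normedModType R) (A : set V).

Definition in_cspan : {pred V} := fun v => `[< cspan A v >].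

Lemma in_cspan_submod_closed : submod_closed in_cspan.
Proof.
have [A0 Al] := cspan_subspace A.
split; first exact/asboolP.
by move=> a u v /asboolP Au /asboolP Av; apply/asboolP; exact: Al.
Qed.

HB.instance Definition _ :=
  GRing.isSubmodClosed.Build R V in_cspan in_cspan_submod_closed.

Record cspan_type := CspanType {
  cspan_val :> V; cspan_prop : cspan_val \in in_cspan }.

HB.instance Definition _ := [isSub for cspan_val].
HB.instance Definition _ := [Choice of cspan_type by <:].
HB.instance Definition _ := [SubChoice_isSubLmodule of cspan_type by <:].

Lemma cspan_norm_ge0 (u : cspan_type) : 0 <= `|val u|.
Proof. exact: normr_ge0. Qed.

Lemma cspan_normD (u v : cspan_type) : `|val (u + v)| <= `|val u| + `|val v|.
Proof. by rewrite linearD ler_normD. Qed.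

Lemma cspan_normZ a (u : cspan_type) : `|val (a *: u)| = `|a| * `|val u|.
Proof. by rewrite linearZ normrZ. Qed.

Definition cspan_seminorm : seminorm cspan_type :=
  Seminorm cspan_norm_ge0 cspan_normD cspan_normZ.

Lemma exists_cspan v : cspan A v -> exists u : cspan_type, val u = v.
Proof. by move=> /asboolP Av; exists (CspanType Av). Qed.

End ClosedSpan.

Section CompletedSpan.
Variables (R : realType) (V : normedModType R) (I : Type) (h : I -> V).
Variable c : I -> nat.
Hypothesis h_le1 : forall i, `|h i| <= 1.
Hypothesis h_c0 : forall (L : dual V) n (e : R), 0 < e ->
  finite_set [set i | c i = n /\ e < `|L (h i) : R|].

Let S := cspan_type (range h).
Let W : completeNormedModType R := completion (cspan_seminorm (range h)).
Let iota : {linear S -> W} := embed (cspan_seminorm (range h)).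

Let hS i : {u : S | val u = h i}.
Proof. by apply/cid/exists_cspan/sub_cspan; exists i. Qed.

(** Dividing by [(c i).+1] merges the countably many weakly null pieces into one weakly null family:
    as [h] is bounded, only finitely many pieces matter for a given functional and a given [e]. *)
Let g i : W := (c i).+1%:R^-1 *: iota (sval (hS i)).

Let iota_lspan u :
  lspan (range h) (val u) -> lspan [set w | w = 0 \/ exists i, w = g i] (iota u).
Proof.
set G := [set w | _].
pose H := [set v : V | exists2 u' : S, val u' = v & lspan G (iota u')].
have [G0 Gl] := lspan_subspace G.
have Hs : subspace_set H.
  split; first by exists 0; rewrite ?linear0.
  move=> a _ _ [v1 <- Gv1] [v2 <- Gv2].
  by exists (a *: v1 + v2); rewrite linearP//; exact: Gl.
have hH : range h `<=` H.
  move=> _ [i _ <-]; exists (sval (hS i)); first exact: svalP (hS i).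
  have -> : iota (sval (hS i)) = (c i).+1%:R *: g i.
    by rewrite scalerA mulfV ?scale1r// pnatr_eq0.
  by apply: (subspace_setZ _ (lspan_subspace G)); apply: sub_lspan; right; exists i.
by move=> /(lspan_min Hs hH)[u' /val_inj->].
Qed.

Lemma completed_span_WCG : WCG W.
Proof.
exists [set w | w = 0 \/ exists i, w = g i]; split.
  apply: weakly_compact_c0 => L e e0.
  have Lle u : L (iota u) <= `|L| * `|val u|.
    apply: le_trans (ler_norm _) _; apply: le_trans (dual_normP L _) _.
    by rewrite [X in _ * X <= _]norm_embed.
  (* The hypothesis on [h] concerns functionals on all of [V], so [L] is extended from the closed
     span. *)
  have [L' [L'le L'E]] := @hahn_banach _ S V _ (\val : {linear S -> V})
    (L \o iota : {linear S -> R^o}) (norm_sublinear V (normr_ge0 L)) Lle.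
  have [|F [FL FE]] := @bounded_dual _ _ L' `|L| (normr_ge0 L).
    by apply: linear_norm_le => // v; rewrite normrN.
  have LgE i : `|L (g i) : R| = (c i).+1%:R^-1 * `|F (h i) : R|.
    have -> : F (h i) = L (iota (sval (hS i))).
      by rewrite FE; have := L'E (sval (hS i)); rewrite /= (svalP (hS i)).
    have -> : L (g i) = (c i).+1%:R^-1 * L (iota (sval (hS i))) :> R.
      exact: linearZ.
    by rewrite normrM ger0_norm// invr_ge0.
  pose N := (Num.Def.truncn (`|L| / e)).+1.
  have LN : `|L| / e < N%:R by exact: Num.Theory.truncnS_gt.
  have F1 i : `|F (h i) : R| <= `|L|.
    by apply: le_trans (dual_le _ FL) _; rewrite ler_piMr.
  apply: sub_finite_set (_ : _ `<=` \bigcup_(n in `I_N)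
      [set i | c i = n /\ e < `|F (h i) : R|]) _.
    move=> i /=; rewrite LgE => ei.
    have ec : e * (c i).+1%:R < `|F (h i) : R| by rewrite mulrC -ltr_pdivlMl.
    exists (c i).
      rewrite /= -(ltr_nat R); apply: le_lt_trans LN; apply: ltW.
      rewrite ltr_pdivlMr// mulrC; apply: lt_le_trans (F1 i).
      by apply: le_lt_trans ec; rewrite ler_wpM2l ?(ltW e0)// ler_nat.
    split=> //; apply: le_lt_trans ec.
    by rewrite ler_peMr ?(ltW e0)// ler1n.
  by apply: bigcup_finite => [|n _]; [exact: finite_II|exact: h_c0].
apply/seteqP; split=> // w _; apply/closure_normP => e e0.
have e2 : 0 < e / 2 by rewrite divr_gt0.
have [u wu] := embed_approx w e2.
have /asboolP/closure_normP/(_ _ e2)[v hv uv] := cspan_prop u.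
have [v' v'E] := exists_cspan (subset_closure hv).
exists (iota v'); first by apply: iota_lspan; rewrite v'E.
rewrite -(subrKA (iota u)) (splitr e); apply: le_lt_trans (ler_normD _ _) _.
have -> : `|iota u - iota v'| = `|val u - v|.
  rewrite -linearB -v'E -(linearB (\val : {linear S -> V})).
  exact: norm_embed.
exact: ltrD.
Qed.

End CompletedSpan.

Lemma isometry_closed_range (R : realType) (X : completeNormedModType R)
    (W : normedModType R) (j : {linear X -> W}) :
  (forall x, `|j x| = `|x|) -> closed (range j).
Proof.
move=> jx w /closure_normP jw.
pose e n : R := n.+1%:R^-1.
have e0 n : 0 < e n by rewrite invr_gt0.
have /choice[y yP] n : exists y, `|w - j y| < e n.
  by have [_ [y _ <-] wy] := jw _ (e0 n); exists y.
have : cvg (y @ \oo).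
  apply/cauchy_cvgP/cauchy_exP => d d0.
  have [N hN] := @natSinv_small R (d / 2) ltac:(by rewrite divr_gt0).
  exists (y N), N => // n /= Nn; rewrite -ball_normE /= -jx linearB.
  rewrite -(subrKA w) (splitr d); apply: le_lt_trans (ler_normD _ _) _.
  apply: ltrD; first by rewrite distrC (lt_trans (yP _))// hN.
  by rewrite (lt_trans (yP _))// hN.
move=> /cvg_ex[l yl]; exists l => //; apply/eqP; rewrite -subr_eq0 -normr_le0.
apply/ler_addgt0Pr => d d0; rewrite add0r.
have d2 : 0 < d / 2 by rewrite divr_gt0.
have [N hN] := natSinv_small d2; have /cvgrPdist_lt/(_ _ d2)[N' _ hN'] := yl.
pose n := maxn N N'.
rewrite -(subrKA (j (y n))) (splitr d); apply: le_trans (ler_normD _ _) _.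
apply: lerD.
  by rewrite -linearB jx; apply: ltW; apply: hN'; exact: leq_maxr.
by rewrite distrC; apply: ltW; rewrite (lt_trans (yP _))// hN// leq_maxl.
Qed.

(** * Embedding of a space with a total shrinking family *)

Section Embedding.
Variables (R : realType) (E : completeNormedModType R) (I : choiceType).
Variable x : I -> E.
Hypothesis x_shrinking : shrinking x.
Hypothesis x_le1 : forall i, `|x i| <= 1.

Let ball := {f : dual E | `|f| <= 1}.
Let V := bfun R ball.

Let ev_exists (y : E) : {u : V | forall f : ball, u f = sval f y}.
Proof.
apply: cid; apply: (@exists_bfun R ball (fun f => sval f y) `|y|) => f.
by apply: dual_le1; exact: svalP f.
Qed.

Let ev y := sval (ev_exists y).
Let evE y f : ev y f = sval f y := svalP (ev_exists y) f.

Let ev_linear : linear ev.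
Proof.
move=> a y z; apply/val_inj/funext => f /=.
rewrite [LHS]evE linearP [RHS](_ : _ = a *: ev y f + ev z f)//.
by rewrite !evE.
Qed.

HB.instance Definition _ := GRing.isLinear.Build R E V _ ev ev_linear.

Let norm_ev y : `|ev y| = `|y|.
Proof.
apply/le_anti/andP; split.
  by apply: bfun_norm_le => // f; rewrite evE; apply: dual_le1; exact: svalP f.
have [f [f1 fy]] := norming_functional y.
apply: le_trans (bfun_norm_ge (ev y) (exist _ f f1)).
by rewrite evE /= fy normr_id.
Qed.

Let d (p : nat) : R := p.+1%:R^-1.

(** Cutting off small values changes the evaluation at [x i] by at most [d p] in norm, and leaves as
    its support a set of functionals that are large at [x i]. *)
Let h_exists (ip : I * nat) : {u : V | forall f : ball,
  u f = if `|sval f (x ip.1) : R| <= d ip.2 then 0 else sval f (x ip.1)}.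
Proof.
apply: cid; apply: (@exists_bfun R ball _ 1) => f.
case: ifP => _; first by rewrite normr0 ler01.
by apply: le_trans (x_le1 ip.1); apply: dual_le1; exact: svalP f.
Qed.

Let h ip := sval (h_exists ip).
Let hE ip f : h ip f = if `|sval f (x ip.1) : R| <= d ip.2 then 0
  else sval f (x ip.1) := svalP (h_exists ip) f.

Let d_gt0 p : 0 < d p. Proof. by rewrite invr_gt0. Qed.

Let h_pt_le1 ip f : `|h ip f : R| <= 1.
Proof.
rewrite hE; case: ifP => _; first by rewrite normr0 ler01.
by apply: le_trans (x_le1 ip.1); apply: dual_le1; exact: svalP f.
Qed.

Let h_le1 ip : `|h ip| <= 1. Proof. exact: bfun_le1. Qed.

Let ev_h i p : `|ev (x i) - h (i, p)| <= d p.
Proof.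
apply: bfun_norm_le => [|f]; first exact: ltW.
rewrite [X in `|X|](_ : _ = ev (x i) f - h (i, p) f)// evE hE /=.
by case: ifP => [xd|_]; rewrite ?subr0// subrr normr0 ltW.
Qed.

Let k_exists p : {k : I -> nat | forall (f : dual E) n,
  `|f| <= 1 -> finite_set [set i | k i = n /\ d p / 2 < `|f (x i) : R|]}.
Proof. by apply: cid; apply: x_shrinking; rewrite divr_gt0. Qed.

Let k p := sval (k_exists p).

Let c (ip : I * nat) : nat := pickle (ip.2, k ip.2 ip.1).

(** Otherwise infinitely many supports [U i] from one piece have variation at least [e]. Functionals
    in their finite intersections have a weak* cluster point that is large at infinitely many [x i]
    of the piece, against the shrinking property. *)
Let h_c0 (L : dual V) n (e : R) : 0 < e ->
  finite_set [set ip | c ip = n /\ e < `|L (h ip) : R|].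
Proof.
move=> e0; set S := [set ip | _].
have [[[i0 p] [/= c0 _]]|S0] := pselect (exists ip, S ip); last first.
  by rewrite (_ : S = set0)//; apply/seteqP; split=> // ip Sip; case: S0; exists ip.
pose J := [set i | k p i = k p i0 /\ e < `|L (h (i, p)) : R|].
have SJ : S `<=` [set (i, p) | i in J].
  move=> [i q] [/= cn Le]; have : (q, k q i) = (p, k p i0).
    by apply: (pcan_inj pickleK); rewrite [LHS]cn -c0.
  by move=> [qp ki]; rewrite qp in Le ki *; exists i.
apply: sub_finite_set SJ _; apply: finite_image; apply: contrapT => Jinf.
pose U i := [set f : ball | h (i, p) f != 0].
have [|j [t [j_inj Jj Ujt]]] := @tv_intersections R ball L I U J e e0 Jinf.
  move=> i [_ /ltW ei]; apply: le_trans ei _; apply: tv_norm_ge => //.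
  by move=> f /negP; rewrite negbK => /eqP.
have [F [FU _ Ffin]] := cofinite_ultra infinite_nat.
have [f [f1 fP]] := @dual_ultralimit R E nat F (fun m => sval (t m)) FU
  (fun m => svalP (t m)).
(* The limit only inherits a non-strict inequality with [d p]; hence the threshold [d p / 2] in
   [k_exists]. *)
have jf m : d p / 2 < `|f (x (j m)) : R|.
  apply: (@lt_le_trans _ _ (d p)).
    by rewrite ltr_pdivrMr// ltr_pMr// ltr1n.
  have fn : (fun l => `|sval (t l) (x (j m)) : R|) @ F --> `|f (x (j m)) : R|.
    exact: cvg_norm (fP _).
  apply: (@cvgr_to_ge _ F _ _ _ _ _ fn).
  have Fm : F (~` `I_m) by apply: Ffin; exact: finite_II.
  apply: filterS Fm => l /= /negP; rewrite -leqNgt => ml.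
  have := Ujt m l ml; rewrite /U /= hE /=.
  by case: ifP => [_|]; rewrite ?eqxx// => /negbT; rewrite -ltNge => /ltW.
have fin := svalP (k_exists p) f (k p i0) f1.
apply: infinite_nat; rewrite -(eq_finite_set (inj_card_eq (A := setT) (in2W j_inj))).
apply: sub_finite_set fin => _ [m _ <-]; split; last exact: jf.
by have [] := Jj m.
Qed.

(** The [h (i, p)] approximate [ev (x i)], so [ev] maps [E] isometrically into their closed span. *)
Lemma shrinking_embedding : cspan (range x) = setT -> subspace_of_WCG E.
Proof.
move=> xT.
have evh y : cspan (range h) (ev y).
  have ev1 (z : E) : `|(ev : {linear E -> V}) z| <= 1 * `|z|.
    by rewrite mul1r norm_ev.
  apply: (cspan_image_sub ev1) (_ : cspan (range x) y); last by rewrite xT.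
  move=> _ [i _ <-]; apply/closure_normP => r r0.
  have [p pr] : exists p, d p < r.
    by have [p pr] := natSinv_small r0; exists p; exact: pr.
  exists (h (i, p)); first by apply: sub_lspan; exists (i, p).
  exact: le_lt_trans (ev_h i p) pr.
have /choice[s sE] y := exists_cspan (evh y).
have sl : linear s.
  move=> a y z; apply: val_inj.
  rewrite [LHS]sE [LHS]ev_linear -[ev y]sE -[ev z]sE.
  by rewrite [RHS](linearP (\val : {linear cspan_type (range h) -> V})).
pose sL : {linear E -> cspan_type (range h)} :=
  HB.pack s (GRing.isLinear.Build _ _ _ _ _ sl).
pose W : completeNormedModType R := completion (cspan_seminorm (range h)).
pose j : {linear E -> W} := embed (cspan_seminorm (range h)) \o sL.
have jn y : `|j y| = `|y| by rewrite [LHS]norm_embed /= sE norm_ev.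
exists W; split; first exact: completed_span_WCG h_le1 h_c0.
exists j; split.
- apply: bounded_linear_continuous; apply/linear_boundedP.
  exists 1; split=> [|M M1 y]; first exact: real1.
  by rewrite jn ler_peMl// ltW.
- by exists 1 => // y; rewrite mul1r jn.
- exact: isometry_closed_range.
Qed.

End Embedding.

Lemma shrinking_subspace_of_WCG (R : realType) (E : completeNormedModType R)
    (I : Type) (x : I -> E) :
  shrinking x -> (forall i, `|x i| <= 1) -> cspan (range x) = setT ->
  subspace_of_WCG E.
Proof.
by elim/Pchoice: I => I in x *; exact: shrinking_embedding.
Qed.
(** * Projective tensor products *)

Section ElementaryTensors.
Variables (R : realType) (X Y : completeNormedModType R).

Let tens_subproof (x : X) (y : Y) : tsum [:: (x, y)] \in @is_tensor R X Y.
Proof. by apply/asboolP; exists [:: (x, y)]. Qed.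

Definition tens x y : tensor X Y := Tensor (tens_subproof x y).

Lemma tens_linearl y : linear (tens^~ y).
Proof.
move=> a x x'; apply/val_inj/funext => A /=.
by rewrite [RHS](_ : _ = a *: tens x y A + tens x' y A)// /= /tsum !big_seq1 linearPl.
Qed.

Lemma tens_linearr x : linear (tens x).
Proof.
move=> a y y'; apply/val_inj/funext => A /=.
by rewrite [RHS](_ : _ = a *: tens x y A + tens x y' A)// /= /tsum !big_seq1 linearPr.
Qed.

Definition ptens x y : proj_tensor X Y := embed (proj_seminorm X Y) (tens x y).

Lemma ptens_linearl y : linear (ptens^~ y).
Proof. by move=> a x x'; rewrite /ptens tens_linearl linearP. Qed.

Lemma ptens_linearr x : linear (ptens x).
Proof. by move=> a y y'; rewrite /ptens tens_linearr linearP. Qed.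

HB.instance Definition _ x :=
  GRing.isLinear.Build R Y (proj_tensor X Y) _ (ptens x) (ptens_linearr x).

Lemma norm_ptens x y : `|ptens x y| <= `|x| * `|y|.
Proof.
rewrite [leLHS]norm_embed; apply: le_trans (@proj_norm_le _ _ _ _ [:: (x, y)] _) _ => //.
by rewrite /tcost big_seq1.
Qed.

Lemma tensor_sum (u : tensor X Y) :
  exists s : seq (X * Y), u = \sum_(z <- s) tens z.1 z.2.
Proof.
have /asboolP[s us] := tensor_prop u; exists s; apply/val_inj; rewrite /= us {us u}.
elim: s => [|z s IHs]; first by rewrite big_nil; apply/funext => A; rewrite /tsum big_nil.
by rewrite big_cons -cat1s tsum_cat IHs; case: z.
Qed.

Lemma cspan_ptens (I J : Type) (x : I -> X) (y : J -> Y) :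
  cspan (range x) = setT -> cspan (range y) = setT ->
  cspan (range (fun ij : I * J => ptens (x ij.1) (y ij.2))) = setT.
Proof.
move=> xT yT; set V := cspan _.
have Vs : subspace_set V by exact: cspan_subspace.
have Vx x' j : V (ptens x' (y j)).
  pose T : {linear X -> proj_tensor X Y} := HB.pack (ptens^~ (y j))
    (GRing.isLinear.Build _ _ _ _ _ (ptens_linearl (y j))).
  have TC z : `|T z| <= `|y j| * `|z| by rewrite mulrC; exact: norm_ptens.
  apply: (cspan_image_sub TC) (_ : cspan (range x) x'); last by rewrite xT.
  by move=> _ [i _ <-]; apply: sub_cspan; exists (i, j).
have Vxy x' y' : V (ptens x' y').
  have TC z : `|ptens x' z| <= `|x'| * `|z| by exact: norm_ptens.
  apply: (cspan_image_sub TC) (_ : cspan (range y) y'); last by rewrite yT.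
  by move=> _ [j _ <-]; exact: Vx.
have Ve : range (embed (proj_seminorm X Y)) `<=` V.
  move=> _ [u _ <-]; have [s ->] := tensor_sum u.
  by rewrite linear_sum; apply: (subspace_set_sum _ Vs) => z; exact: Vxy.
apply/seteqP; split=> // w _.
have : closure V w.
  by apply: closure_subset Ve _ _; rewrite embed_dense.
by rewrite /V /cspan -(closure_id _).1//; exact: closed_closure.
Qed.

(** One half of the duality between the projective tensor product and the operators from [X] to the
    dual of [Y]. *)
Lemma tensor_operator (G : dual (proj_tensor X Y)) : `|G| <= 1 ->
  exists T : {linear X -> dual Y},
    (forall x, `|T x| <= `|x|) /\ forall x y, T x y = G (ptens x y).
Proof.
move=> G1.
have /choice[T TP] (x : X) : exists g : dual Y,
    `|g| <= `|x| /\ forall y, g y = G (ptens x y).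
  apply: (@bounded_dual _ _ (G \o ptens x : {linear Y -> R^o})) => // y.
  by apply: le_trans (dual_le1 _ G1) (norm_ptens x y).
have Tl : linear T.
  move=> a x x'; apply/val_inj/funext => y.
  rewrite [RHS](_ : _ = a *: T x y + T x' y)//.
  rewrite [LHS](TP _).2 (TP x).2 (TP x').2 ptens_linearl.
  exact: linearP.
pose TL : {linear X -> dual Y} := HB.pack T (GRing.isLinear.Build _ _ _ _ _ Tl).
by exists TL; split=> x; [exact: (TP x).1|move=> y; exact: (TP x).2].
Qed.

(* A norm cluster point of infinitely many T x_i has norm at most e / 2, because
   the T x_i (y) are small for each y. *)
Lemma compact_operator_finite (I : Type) (x : I -> X) (A : set I)
    (T : {linear X -> dual Y}) (e : R) :
  0 < e -> (forall i, `|x i| <= 1) -> (forall z, `|T z| <= `|z|) ->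
  precompact (T @` [set z : X | `|z| <= 1]) ->
  (forall f : dual X, `|f| <= 1 ->
    finite_set [set i | A i /\ e / 2 < `|f (x i) : R|]) ->
  finite_set [set i | A i /\ e < `|T (x i)|].
Proof.
move=> e0 x1 T1; rewrite precompactE => Tc xfin; set S := [set i | _].
have e2 : 0 < e / 2 by rewrite divr_gt0.
apply: contrapT => /cofinite_ultra[U [UU US Ufin]].
have [|g _ gP] := @compact_ultra_cvg I (dual Y) U (T \o x) _ UU Tc.
  by apply: filterS US => i _ /=; apply: subset_closure; exists (x i) => //; exact: x1.
have g_le : `|g| <= e / 2.
  apply: dual_norm_le => y y1; apply/ler_addgt0Pr => r r0.
  (* For fixed [y], the values [T z y] form a functional of [z], to which the hypothesis on the
     [x i] applies. *)
  have [f [f1 fE]] : exists f : dual X, `|f| <= 1 /\ forall z, f z = T z y.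
    have l : linear (fun z => T z y : R^o).
      by move=> a u v; rewrite linearP.
    pose L : {linear X -> R^o} := HB.pack (fun z => T z y : R^o)
      (GRing.isLinear.Build _ _ _ _ _ l).
    apply: (@bounded_dual _ _ L 1) => // z; rewrite mul1r /=.
    apply: le_trans (dual_normP (T z) y) _; apply: le_trans (T1 z).
    by rewrite ler_piMr// dual_norm_ge0.
  have Ur : U [set i | `|g - T (x i)| < r] by move/cvgrPdist_lt: gP => /(_ r r0).
  have [i [[[Ai _] ni] gi]] := filter_ex (filterI (filterI US (Ufin _ (xfin f f1))) Ur).
  have fi : `|T (x i) y : R| <= e / 2.
    by rewrite leNgt; apply/negP; rewrite -fE => ei; apply: ni.
  have gTi : `|(g - T (x i)) y : R| <= r.
    apply: le_trans (dual_normP _ y) _; apply: le_trans (ltW gi).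
    by rewrite ler_piMr// dual_norm_ge0.
  have -> : g y = T (x i) y + (g - T (x i)) y :> R.
    by rewrite [X in _ = _ + X](_ : _ = g y - T (x i) y)// addrC subrK.
  by apply: le_trans (ler_normD _ _) _; exact: lerD.
have Ue : U [set i | `|g - T (x i)| < e / 2] by move/cvgrPdist_lt: gP => /(_ _ e2).
have [i [[_ ei] gi]] := filter_ex (filterI US Ue).
move: ei; apply/negP; rewrite -leNgt (splitr e).
have -> : T (x i) = g - (g - T (x i)) by rewrite opprB addrC subrK.
by apply: le_trans (ler_normB _ _) _; apply: lerD => //; exact: ltW.
Qed.

Lemma shrinking_ptens (I J : Type) (x : I -> X) (y : J -> Y) :
  operators X (dual Y) = compact_operators X (dual Y) ->
  shrinking x -> (forall i, `|x i| <= 1) ->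
  shrinking y -> (forall j, `|y j| <= 1) ->
  shrinking (fun ij : I * J => ptens (x ij.1) (y ij.2)).
Proof.
move=> XY xs x1 ys y1 e e0.
(* [compact_operator_finite] loses a factor 2. *)
have [kx kxP] := xs (e / 2) ltac:(by rewrite divr_gt0).
have [ky kyP] := ys e e0.
exists (fun ij => pickle (kx ij.1, ky ij.2)) => G n G1.
set S := [set ij | _].
have [[[i0 j0] [/= n0 _]]|S0] := pselect (exists ij, S ij); last first.
  by rewrite (_ : S = set0)//; apply/seteqP; split=> // ij Sij; case: S0; exists ij.
have [T [T1 TE]] := tensor_operator G1.
have Tc : compact_operators X (dual Y) T.
  rewrite -XY /operators /=; apply: bounded_linear_continuous.
  apply/linear_boundedP; exists 1; split=> [|M M1 z]; first exact: real1.
  by apply: le_trans (T1 z) _; rewrite ler_peMl// ltW.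
have fin := @compact_operator_finite I x [set i | kx i = kx i0] T e e0 x1 T1 Tc.2
  (fun f => kxP f (kx i0)).
apply: sub_finite_set (_ : _ `<=` \bigcup_(i in [set i | kx i = kx i0 /\ e < `|T (x i)|])
  [set (i, j) | j in [set j | ky j = ky j0 /\ e < `|T (x i) (y j) : R|]]) _.
  move=> [i j] [/= ijn]; rewrite -TE => eT.
  have [ki kj] : (kx i, ky j) = (kx i0, ky j0).
    by apply: (pcan_inj pickleK); rewrite [LHS]ijn -n0.
  exists i; last by exists j.
  split=> //; apply: lt_le_trans eT _; apply: le_trans (dual_normP _ _) _.
  by rewrite ler_piMr// dual_norm_ge0.
apply: bigcup_finite => // i _; apply: finite_image; apply: kyP.
exact: le_trans (T1 _) (x1 i).
Qed.

End ElementaryTensors.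

Theorem corollary5p21 (R : realType) (X Y : completeNormedModType R)
    (hX : subspace_of_WCG X) (hY : subspace_of_WCG Y)
    (hXY : operators X (dual Y) = compact_operators X (dual Y)) :
  subspace_of_WCG (proj_tensor X Y).
Proof.
have [I [x [xs x1 xT]]] := ewc_covered_shrinking (subspace_of_WCG_ewc hX).
have [J [y [ys y1 yT]]] := ewc_covered_shrinking (subspace_of_WCG_ewc hY).
apply: (shrinking_subspace_of_WCG (shrinking_ptens hXY xs x1 ys y1)).
  move=> [i j]; apply: le_trans (norm_ptens _ _) _.
  by rewrite mulr_ile1.
exact: cspan_ptens.
Qed.
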